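(* Let $\mathbb{G}$ be the Gurariĭ space. Then for each $\mathcal{I}\in\{\mathcal{P},\mathcal{P}_\infty,\mathcal{B}\}$ the isometry class $\{\mu\in\mathcal{I}: X_\mu \text{ is linearly isometric to } \mathbb{G}\}$ is a dense $G_\delta$-set in $\mathcal{I}$.
   Context: Banach spaces are real. $V$ is the $\mathbb{Q}$-vector space of finitely supported sequences of rational numbers with canonical basis $(e_n)_{n\in\mathbb{N}}$, and $c_{00}\supseteq V$ is the real vector space of finitely supported real sequences. $\mathcal{P}$ is the set of all pseudonorms (seminorms) on $V$, with the topology inherited from $\mathbb{R}^V$ (pointwise convergence). Each $\mu\in\mathcal{P}$ is identified with its extension to a pseudonorm on $c_{00}$. $X_\mu$ is the Banach space obtained as the completion of the quotient of $(c_{00},\mu)$ by $\{x\in c_{00}:\mu(x)=0\}$. $\mathcal{P}_\infty$ is the set of $\mu\in\mathcal{P}$ with $X_\mu$ infinite-dimensional, and $\mathcal{B}$ is the set of those $\mu\in\mathcal{P}_\infty$ whose extension to $c_{00}$ is a norm; both carry the subspace topology. For $K\ge 1$, a $K$-isomorphism $T:E\to Y$ is a linear map with $K^{-1}\|x\|\le\|Tx\|\le K\|x\|$ for all $x\in E$ (not necessarily surjective). The Gurariĭ space $\mathbb{G}$ is the unique (up to linear isometry) separable Banach space such that for every $\varepsilon>0$ and every linear isometric embedding $g:A\to B$, where $B$ is a finite-dimensional Banach space and $A$ is a subspace of $\mathbb{G}$, there is a $(1+\varepsilon)$-isomorphism $f:B\to\mathbb{G}$ such that $\|f\circ g-\mathrm{id}_A\|\le\varepsilon$.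 *)

(* Defs.v *)
From HB Require Import structures.
From mathcomp Require Import all_boot all_order all_algebra generic_quotient.
From mathcomp Require Import boolp classical_sets functions cardinality filter reals interval_inference.
From mathcomp Require Import topology normedtype sequences borel_hierarchy.
From mathcomp Require Import ring lra.

Set Implicit Arguments.
Unset Strict Implicit.
Unset Printing Implicit Defensive.

Import Order.TTheory GRing.Theory Num.Theory.
Import numFieldNormedType.Exports.

Local Open Scope classical_set_scope.
Local Open Scope quotient_scope.
Local Open Scope ring_scope.

(* The scalars K are embedded in the reals by iota; it is ratr for Q-vector
   spaces and idfun for real ones.  Nonnegativity is not an axiom since it
   follows from the other two, see pseudonorm_ge0. *)
Record pseudonorm (R : realType) (K : numFieldType) (iota : {rmorphism K -> R})
    (E : lmodType K) := Pseudonorm {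
  pn_fun :> E -> R ;
  pseudonormD : forall x y, pn_fun (x + y) <= pn_fun x + pn_fun y ;
  pseudonormZ : forall a x, pn_fun (a *: x) = iota `|a| * pn_fun x }.

Section pseudonorm_theory.
Context (R : realType) (K : numFieldType) (iota : {rmorphism K -> R}).
Context (E : lmodType K) (p : pseudonorm iota E).

Lemma pseudonorm0 : p 0 = 0.
Proof. by rewrite -(scale0r 0) pseudonormZ normr0 rmorph0 mul0r. Qed.

Lemma pseudonormN x : p (- x) = p x.
Proof. by rewrite -scaleN1r pseudonormZ normrN1 rmorph1 mul1r. Qed.

Lemma pseudonorm_distC x y : p (x - y) = p (y - x).
Proof. by rewrite -pseudonormN opprB. Qed.

Lemma pseudonorm_ge0 x : 0 <= p x.
Proof.
have := pseudonormD p x (- x).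
by rewrite subrr pseudonorm0 pseudonormN -mulr2n pmulrn_lge0.
Qed.

Lemma pseudonorm_leB x y : p x - p y <= p (x - y).
Proof. by rewrite lerBlDr -[in leLHS](subrK y x) pseudonormD. Qed.

Lemma pseudonorm_dist x y : `|p x - p y| <= p (x - y).
Proof.
by rewrite ler_norml pseudonorm_leB andbT lerNl opprB pseudonorm_distC pseudonorm_leB.
Qed.

Lemma pseudonorm_sum (I : Type) (s : seq I) (F : I -> E) :
  p (\sum_(i <- s) F i) <= \sum_(i <- s) p (F i).
Proof.
elim/big_rec2: _ => [|i y x _ xy]; first by rewrite pseudonorm0.
by rewrite (le_trans (pseudonormD _ _ _))// lerD2l.
Qed.

End pseudonorm_theory.

Section kernel_quotient.
Context (R : realType) (E : lmodType R) (p : pseudonorm (idfun : {rmorphism R -> R}) E).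

Definition pn_ker : {pred E} := fun x => p x == 0.

Lemma pn_ker_zmod_closed : zmod_closed pn_ker.
Proof.
split=> [|x y]; rewrite ?unfold_in ?pseudonorm0// => /eqP x0 /eqP y0.
rewrite eq_le pseudonorm_ge0 andbT (le_trans (pseudonormD _ _ _))//.
by rewrite pseudonormN x0 y0 addr0.
Qed.
HB.instance Definition _ := GRing.isZmodClosed.Build E pn_ker pn_ker_zmod_closed.

Definition ker_quot : Type := Quotient.quot pn_ker.
HB.instance Definition _ := GRing.Zmodule.on ker_quot.

Definition to_quot (x : E) : ker_quot := \pi_(Quotient.quot pn_ker) x.

Definition of_quot (x : ker_quot) : E := repr (x : Quotient.quot pn_ker).

Lemma of_quotK : cancel of_quot to_quot.
Proof. exact: reprK. Qed.

Lemma to_quot_eq x y : (to_quot x = to_quot y) <-> p (x - y) = 0.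
Proof.
split=> [/eqP|xy]; first by rewrite /to_quot -Quotient.idealrBE => /eqP.
by apply/eqP; rewrite /to_quot -Quotient.idealrBE; apply/eqP.
Qed.

Lemma to_quotK x : p (of_quot (to_quot x) - x) = 0.
Proof. by apply/to_quot_eq; rewrite of_quotK. Qed.

Lemma to_quot_zmod_morphism : zmod_morphism to_quot.
Proof. by move=> x y; rewrite /to_quot raddfB. Qed.
HB.instance Definition _ :=
  GRing.isZmodMorphism.Build E ker_quot to_quot to_quot_zmod_morphism.

Definition quot_scale (a : R) (x : ker_quot) : ker_quot :=
  to_quot (a *: of_quot x).

Lemma to_quotZ a x : quot_scale a (to_quot x) = to_quot (a *: x).
Proof.
by apply/to_quot_eq; rewrite -scalerBr pseudonormZ to_quotK mulr0.
Qed.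

Lemma quot_scaleA a b x :
  quot_scale a (quot_scale b x) = quot_scale (a * b) x.
Proof. by rewrite -[x]of_quotK !to_quotZ scalerA. Qed.

Lemma quot_scale1 : left_id 1 quot_scale.
Proof. by move=> x; rewrite -[x]of_quotK !to_quotZ scale1r. Qed.

Lemma quot_scaleDr : right_distributive quot_scale +%R.
Proof.
move=> a x y; rewrite -[x]of_quotK -[y]of_quotK -raddfD !to_quotZ.
by rewrite scalerDr raddfD.
Qed.

Lemma quot_scaleDl x : {morph quot_scale^~ x : a b / a + b}.
Proof. by move=> a b; rewrite -[x]of_quotK !to_quotZ scalerDl raddfD. Qed.

HB.instance Definition _ := GRing.Zmodule_isLmodule.Build R ker_quot
  quot_scaleA quot_scale1 quot_scaleDr quot_scaleDl.

Lemma to_quot_scalable : scalable to_quot.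
Proof. by move=> a x; rewrite -to_quotZ. Qed.
HB.instance Definition _ :=
  GRing.isScalable.Build R E ker_quot *:%R to_quot to_quot_scalable.

Definition quot_norm (x : ker_quot) : R := p (of_quot x).

Lemma quot_normE x : quot_norm (to_quot x) = p x.
Proof.
rewrite /quot_norm; apply/eqP; rewrite -subr_eq0 -normr_le0.
by rewrite (le_trans (pseudonorm_dist _ _ _))// to_quotK.
Qed.

Lemma quot_normD x y : quot_norm (x + y) <= quot_norm x + quot_norm y.
Proof.
rewrite -[x]of_quotK -[y]of_quotK -raddfD !quot_normE; exact: pseudonormD.
Qed.

Lemma quot_normZ a x : quot_norm (a *: x) = `|a| * quot_norm x.
Proof. by rewrite -[x]of_quotK -linearZ !quot_normE pseudonormZ. Qed.

Lemma quot_norm_eq0 x : quot_norm x = 0 -> x = 0.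
Proof.
rewrite -[x]of_quotK quot_normE => x0; rewrite -(raddf0 to_quot).
by apply/to_quot_eq; rewrite subr0.
Qed.

HB.instance Definition _ := Lmodule_isNormed.Build R ker_quot
  quot_normD quot_normZ quot_norm_eq0.

Lemma norm_to_quot x : `|to_quot x| = p x.
Proof. exact: quot_normE. Qed.

End kernel_quotient.

(* The completion of a normed space, as the Cauchy sequences modulo those of
   norm tending to 0. *)
Section completion.
Context (R : realType) (N : normedModType R).

Definition is_cauchy_seq : {pred nat -> N} := fun u => `[< cauchy (u @ \oo) >].

Lemma is_cauchy_seqP (u : nat -> N) :
  reflect (forall e, 0 < e -> exists n0, forall m n, (n0 <= m)%N -> (n0 <= n)%N ->
            `|u m - u n| < e) (u \in is_cauchy_seq).
Proof.
apply: (iffP (asboolP _)) => [/cauchy_ballP cu e e0|cu].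
  have /(_ e e0)[[/= A B] [[a _ aA] [b _ bB]] AB] := cu.
  exists (maxn a b) => m n; rewrite !geq_max => /andP[am _] /andP[_ bn].
  have := AB (u m, u n); rewrite -ball_normE; apply; split => /=.
    exact: aA.
  exact: bB.
apply/cauchy_ballP => e e0; have [n0 hn] := cu e e0.
exists (u @` [set n | (n0 <= n)%N], u @` [set n | (n0 <= n)%N]) => /=.
  by split; exists n0 => // n /= n0n; exists n.
move=> [_ _] [/= [m n0m <-] [n n0n <-]]; rewrite -ball_normE /=; exact: hn.
Qed.

Lemma is_cauchy_seq_submod_closed : submod_closed is_cauchy_seq.
Proof.
split=> [|a u v /is_cauchy_seqP cu /is_cauchy_seqP cv]; apply/is_cauchy_seqP => e e0.
  by exists 0 => m n _ _; rewrite subrr normr0.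
have e20 : 0 < e / 2 by rewrite divr_gt0.
have a0 : 0 < `|a| + 1 by rewrite ltr_pwDr.
have [n1 h1] := cu _ (divr_gt0 e20 a0); have [n2 h2] := cv _ e20.
exists (maxn n1 n2) => m n; rewrite !geq_max => /andP[m1 m2] /andP[l1 l2].
rewrite [X in `|X|](_ : _ = a *: (u m - u n) + (v m - v n)); last first.
  by rewrite /= scalerBr addrACA opprD.
rewrite (le_lt_trans (ler_normD _ _))// [e]splitr ltr_leD// ?(ltW (h2 _ _ _ _))//.
rewrite normrZ (@le_lt_trans _ _ ((`|a| + 1) * `|u m - u n|))//.
  by rewrite ler_wpM2r// lerDl.
by rewrite mulrC -ltr_pdivlMr// h1.
Qed.

Record cauchy_sequence := CauchySequence {
  cauchy_seq :> nat -> N ; _ : cauchy_seq \in is_cauchy_seq }.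

HB.instance Definition _ := [isSub for cauchy_seq].
HB.instance Definition _ := [Choice of cauchy_sequence by <:].
HB.instance Definition _ := GRing.isSubmodClosed.Build R (nat -> N) is_cauchy_seq
  is_cauchy_seq_submod_closed.
HB.instance Definition _ := [SubChoice_isSubLmodule of cauchy_sequence by <:].

Definition limit_norm (u : cauchy_sequence) : R := limn (fun n => `|u n|).

Lemma limit_norm_cvg (u : cauchy_sequence) : `|u n| @[n --> \oo] --> limit_norm u.
Proof.
suff : cvgn (fun n => `|u n|) by [].
apply/cauchy_cvgP/cauchy_ballP => e e0.
have /is_cauchy_seqP /(_ e e0)[n0 hn] := valP u.
pose A : set R := (fun n => `|u n|) @` [set n | (n0 <= n)%N].
exists (A, A) => /=.
  by split; exists n0 => // n /= n0n; exists n.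
move=> [_ _] [/= [m n0m <-] [n n0n <-]]; rewrite -ball_normE /=.
by rewrite (le_lt_trans (ler_dist_dist _ _))// hn.
Qed.

#[local] Arguments limit_norm_cvg : clear implicits.

Lemma limit_normD u v : limit_norm (u + v) <= limit_norm u + limit_norm v.
Proof.
apply: (ler_cvg_to (limit_norm_cvg (u + v))
  (cvgD (limit_norm_cvg u) (limit_norm_cvg v))).
by apply: nearW => n; exact: ler_normD.
Qed.

Lemma limit_normZ a u : limit_norm (a *: u) = idfun `|a| * limit_norm u.
Proof.
apply/(cvg_unique (@norm_hausdorff _ _) (limit_norm_cvg (a *: u))).
have : `|a| * `|u n| @[n --> \oo] --> `|a| * limit_norm u.
  by apply: cvgMl_tmp; exact: limit_norm_cvg.
apply: cvg_trans.
by apply: near_eq_cvg; apply: nearW => n; rewrite /= normrZ.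
Qed.

Definition limit_pseudonorm :=
  Pseudonorm (iota := (idfun : {rmorphism R -> R})) limit_normD limit_normZ.

Definition completion : Type := ker_quot limit_pseudonorm.
HB.instance Definition _ := NormedModule.on completion.

Lemma const_is_cauchy_seq (x : N) : (fun=> x) \in is_cauchy_seq.
Proof. by apply/is_cauchy_seqP => e e0; exists 0%N => *; rewrite subrr normr0. Qed.

Definition to_completion (x : N) : completion :=
  to_quot limit_pseudonorm (CauchySequence (const_is_cauchy_seq x)).

Lemma to_completion_linear : linear to_completion.
Proof.
by move=> a x y; rewrite /to_completion -linearP; congr to_quot; exact/val_inj.
Qed.
HB.instance Definition _ := GRing.isLinear.Build R N completion *:%R
  to_completion to_completion_linear.

Lemma norm_to_completion x : `|to_completion x| = `|x|.
Proof. by rewrite norm_to_quot /= /limit_norm /= lim_cst. Qed.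

Let dist_to_completion (u : cauchy_sequence) (n0 : nat) (e : R) :
  (forall m, (n0 <= m)%N -> `|u m - u n0| < e) ->
  `|to_quot limit_pseudonorm u - to_completion (u n0)| <= e.
Proof.
move=> un; rewrite /to_completion -raddfB norm_to_quot /=.
apply: (cvgr_to_le (limit_norm_cvg _)).
by exists n0 => // m /= n0m; rewrite ltW// un.
Qed.

Lemma to_completion_dense (z : completion) e :
  0 < e -> exists x, `|z - to_completion x| < e.
Proof.
move=> e0; rewrite -[z]of_quotK; set u := of_quot _.
have e20 : 0 < e / 2 by rewrite divr_gt0.
have /is_cauchy_seqP /(_ _ e20)[n0 hn] := valP u.
exists (u n0); rewrite (@le_lt_trans _ _ (e / 2))//.
  by apply: dist_to_completion => m n0m; exact: hn.
by rewrite gtr_pMr// invf_lt1// ltr1n.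
Qed.

Lemma completion_complete (F : set_system completion) :
  ProperFilter F -> cauchy F -> cvg F.
Proof.
move=> PF /cauchyP cF.
have near_pt n : exists x : N, F (ball (to_completion x) (n.+1%:R^-1)).
  have n0 : (0 : R) < n.+1%:R^-1 / 2 by rewrite divr_gt0// invr_gt0.
  have [z Fz] := cF _ n0; have [x zx] := to_completion_dense z n0.
  exists x; apply: filterS Fz => y; rewrite -!ball_normE /= => zy.
  rewrite distrC in zx.
  by rewrite [ltRHS]splitr (le_lt_trans (ler_distD z _ _))// ltrD.
have [x Fx] := choice near_pt.
have small e : 0 < e -> exists n0, forall n, (n0 <= n)%N -> n.+1%:R^-1 < e :> R.
  move=> /posnumP[{}e]; have [n0 _ hn] := near_infty_natSinv_lt e.
  by exists n0 => n; exact: hn.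
have cx : x \in is_cauchy_seq.
  apply/is_cauchy_seqP => e e0; have [n0 hn] := small _ (divr_gt0 e0 (@ltr0n R 2)).
  exists n0 => m n n0m n0n.
  have [y [ym yn]] := filter_ex (filterI (Fx m) (Fx n)).
  move: ym yn; rewrite -!ball_normE /= => ym; rewrite distrC => yn.
  rewrite -norm_to_completion raddfB [e]splitr (le_lt_trans (ler_distD y _ _))//.
  by rewrite ltrD// ?(lt_trans ym) ?(lt_trans yn) ?hn.
apply/cvg_ex; exists (to_quot limit_pseudonorm (CauchySequence cx)).
apply/fcvgrPdist_lt => e e0; have e20 := divr_gt0 e0 (@ltr0n R 2).
have [n0 hn] := small _ e20; have /is_cauchy_seqP /(_ _ e20)[n1 hx] := cx.
pose n := maxn n0 n1; apply: filterS (Fx n) => y; rewrite -ball_normE /= => xy.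
rewrite [e]splitr (le_lt_trans (ler_distD (to_completion (x n)) _ _))//.
rewrite ler_ltD// ?(lt_trans xy) ?hn ?leq_maxl//.
apply: (dist_to_completion (u := CauchySequence cx)) => m nm; apply: hx.
  by rewrite (leq_trans (leq_maxr _ _) nm).
exact: leq_maxr.
Qed.
HB.instance Definition _ := Uniform_isComplete.Build completion completion_complete.

End completion.

(* Finitely supported sequences are represented by polynomials: p stands for the
   sequence of its coefficients p`_i and 'X^i for the basis vector e_i; the
   product of polynomials plays no role.  A pseudonorm on the rational space
   extends in exactly one way to the real one. *)
Section extension.
Context (R : realType) (mu : pseudonorm (ratr : {rmorphism rat -> R}) {poly rat}).
Local Notation real_pseudonorm := (pseudonorm (idfun : {rmorphism R -> R}) {poly R}).
Local Notation toR := (map_poly (ratr : {rmorphism rat -> R})).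

Let c i := mu 'X^i.
Let c0 i : 0 <= c i. Proof. exact: pseudonorm_ge0. Qed.

Let w (x : {poly R}) := \sum_(i < size x) `|x`_i| * c i.

Let wE n (x : {poly R}) : (size x <= n)%N -> w x = \sum_(i < n) `|x`_i| * c i.
Proof.
move=> xn; rewrite /w (big_ord_widen n (fun i => `|x`_i| * c i) xn) big_mkcond /=.
by apply: eq_bigr => i _; case: ltnP => // xi; rewrite nth_default// normr0 mul0r.
Qed.

Let wD x y : w (x + y) <= w x + w y.
Proof.
pose n := maxn (size x) (size y).
rewrite (@wE n) ?size_polyD// (@wE n x) ?leq_maxl// (@wE n y) ?leq_maxr//.
rewrite -big_split ler_sum// => i _; rewrite /= coefD -mulrDl ler_wpM2r//.
exact: ler_normD.
Qed.

Let wZ a x : w (a *: x) = `|a| * w x.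
Proof.
rewrite (@wE (size x)) ?size_scale_leq// mulr_sumr; apply: eq_bigr => i _.
by rewrite coefZ normrM mulrA.
Qed.

Let w0 x : 0 <= w x.
Proof. by apply: sumr_ge0 => i _; rewrite mulr_ge0. Qed.

Let wN x : w (- x) = w x.
Proof. by rewrite -scaleN1r wZ normrN1 mul1r. Qed.

Let w_dense x e : 0 < e -> exists v, w (x - toR v) < e.
Proof.
move=> e0; pose s := 1 + \sum_(i < size x) c i.
have s0 : 0 < s by rewrite ltr_pwDl// sumr_ge0.
have /choice[q qP] i : exists q : rat, `|x`_i - ratr q| <= e / s / 2.
  have d0 : 0 < e / s / 2 by rewrite !divr_gt0.
  have /rat_in_itvoo[q] : x`_i < x`_i + e / s / 2 by rewrite ltrDl.
  rewrite in_itv /= => /andP[xq qx]; exists q.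
  by rewrite distrC ger0_norm ?subr_ge0 1?ltW// ltrBlDl.
exists (\poly_(i < size x) q i).
have sv : (size (toR (\poly_(i < size x) q i)) <= size x)%N.
  by rewrite (leq_trans (size_poly _ _))// size_poly.
rewrite (@wE (size x)); last first.
  by rewrite (leq_trans (size_polyD _ _))// size_polyN geq_max leqnn.
rewrite (@le_lt_trans _ _ (\sum_(i < size x) e / s / 2 * c i))//.
  apply: ler_sum => i _; rewrite ler_wpM2r// coefB coef_map coef_poly ltn_ord.
  exact: qP.
rewrite -mulr_sumr (@le_lt_trans _ _ (e / s / 2 * s))//.
  by rewrite ler_wpM2l ?divr_ge0 ?ltW// ltrDr.
have -> : e / s / 2 * s = e / 2 by field; lra.
lra.
Qed.

Let mu_le_w v : mu v <= w (toR v).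
Proof.
rewrite /w size_map_poly -{1}(coefK v) poly_def.
rewrite (le_trans (pseudonorm_sum _ _ _))// ler_sum// => i _.
by rewrite pseudonormZ coef_map /= ratr_norm.
Qed.

Let S x := [set mu v + w (x - toR v) | v in [set: {poly rat}]].
Let nu x := inf (S x).

Let S0 x : S x !=set0.
Proof. by exists (mu 0 + w (x - toR 0)), 0. Qed.

Let nu_le x v : nu x <= mu v + w (x - toR v).
Proof.
apply: ge_inf; last by exists v.
by exists 0 => _ [v' _ <-]; rewrite addr_ge0// pseudonorm_ge0.
Qed.

Let le_nu x y : (forall v, y <= mu v + w (x - toR v)) -> y <= nu x.
Proof. by move=> H; apply: lb_le_inf => // _ [v _ <-]. Qed.

Let nu_ge0 x : 0 <= nu x.
Proof. by apply: le_nu => v; rewrite addr_ge0// pseudonorm_ge0. Qed.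

Let nuE v : nu (toR v) = mu v.
Proof.
apply/eqP; rewrite eq_le; apply/andP; split.
  by rewrite (le_trans (nu_le _ v))// subrr /w size_poly0 big_ord0 addr0.
apply: le_nu => v'; rewrite -lerBlDl (le_trans (pseudonorm_leB _ _ _))//.
by rewrite -rmorphB mu_le_w.
Qed.

Let nuD x y : nu (x + y) <= nu x + nu y.
Proof.
rewrite -lerBlDr; apply: le_nu => v; rewrite lerBlDr -lerBlDl.
apply: le_nu => v'; rewrite lerBlDl (le_trans (nu_le _ (v + v')))//.
rewrite rmorphD opprD addrACA [leRHS]addrACA lerD//; exact: pseudonormD.
Qed.

Let nuZ_le a x : nu (a *: x) <= `|a| * nu x.
Proof.
apply/ler_addgt0Pr => e e0.
have d0 : 0 < e / (1 + w x + nu x) by rewrite divr_gt0// -addrA ltr_pwDl// addr_ge0.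
set d := e / _ in d0.
have /rat_in_itvoo[q] : a < a + d by rewrite ltrDl.
rewrite in_itv /= => /andP[aq qa].
have daq : `|a - ratr q| <= d by rewrite distrC ger0_norm ?subr_ge0 1?ltW// ltrBlDl.
have qd : `|ratr q| <= `|a| + d.
  by rewrite -[ratr q](subrK a) addrC (le_trans (ler_normD _ _))// lerD2l distrC.
have H v : nu (a *: x) <= `|ratr q| * (mu v + w (x - toR v)) + d * w x.
  rewrite (le_trans (nu_le _ (q *: v)))// mulrDr -addrA lerD//.
    by rewrite pseudonormZ /= ratr_norm.
  rewrite map_polyZ /= (_ : _ - _ = ratr q *: (x - toR v) + (a - ratr q) *: x); last first.
    by rewrite scalerBr scalerBl [RHS]addrC addrA subrK.
  by rewrite (le_trans (wD _ _))// !wZ lerD2l ler_wpM2r.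
have : nu (a *: x) <= `|ratr q| * nu x + d * w x.
  have [q0|q0] := eqVneq (ratr q : R) 0.
    by have := H 0; rewrite q0 normr0 !mul0r.
  have q0' : 0 < `|ratr q : R| by rewrite normr_gt0.
  rewrite -lerBlDr -ler_pdivrMl//; apply: le_nu => v.
  by rewrite ler_pdivrMl// lerBlDr.
move=> /le_trans; apply.
have de : d * (1 + w x + nu x) = e.
  by rewrite divfK// gt_eqF// -addrA ltr_pwDl// addr_ge0.
have := ler_wpM2r (nu_ge0 x) qd.
by have := nu_ge0 x; have := w0 x; nra.
Qed.

Let nuZ a x : nu (a *: x) = idfun `|a| * nu x.
Proof.
have [->|a0] := eqVneq a 0.
  apply/eqP; rewrite eq_le /= normr0 mul0r nu_ge0 andbT.
  by rewrite (le_trans (nuZ_le _ _))// normr0 mul0r.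
apply/eqP; rewrite eq_le nuZ_le /= -ler_pdivlMl ?normr_gt0//.
by rewrite -normfV (le_trans _ (nuZ_le _ _))// scalerA mulVf// scale1r.
Qed.

Lemma pseudonorm_extension_exists :
  exists nu : real_pseudonorm, forall v, nu (toR v) = mu v.
Proof. by exists (Pseudonorm (iota := (idfun : {rmorphism R -> R})) nuD nuZ). Qed.

Definition extension : real_pseudonorm := sval (cid pseudonorm_extension_exists).

Lemma extensionE v : extension (toR v) = mu v.
Proof. exact: (svalP (cid pseudonorm_extension_exists)). Qed.

Let real_le_w (p : real_pseudonorm) : (forall v, p (toR v) = mu v) ->
  forall x, p x <= w x.
Proof.
move=> pE x; rewrite -{1}(coefK x) poly_def.
rewrite (le_trans (pseudonorm_sum _ _ _))// ler_sum// => i _.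
by rewrite pseudonormZ /c -pE map_polyXn.
Qed.

Lemma extension_unique (p : real_pseudonorm) :
  (forall v, p (toR v) = mu v) -> p =1 extension.
Proof.
move=> pE x; apply/eqP; rewrite -subr_eq0 -normr_le0.
apply/ler_addgt0Pr => e e0; rewrite add0r.
have [v xv] := w_dense x (divr_gt0 e0 (@ltr0n R 2)).
rewrite (le_trans (ler_distD (mu v) _ _))// [e]splitr lerD//.
  rewrite -pE (le_trans (pseudonorm_dist _ _ _))//.
  by rewrite (le_trans (real_le_w pE _))// ltW.
rewrite -extensionE distrC (le_trans (pseudonorm_dist _ _ _))//.
by rewrite (le_trans (real_le_w extensionE _))// ltW.
Qed.

End extension.

Section pseudonorm_space.
Context (R : realType).

Definition pseudonorms : Type :=
  pseudonorm (ratr : {rmorphism rat -> R}) {poly rat}.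
HB.instance Definition _ := gen_eqMixin pseudonorms.
HB.instance Definition _ := gen_choiceMixin pseudonorms.
HB.instance Definition _ := Topological.copy pseudonorms
  (initial_topology (fun mu : pseudonorms => (mu : {ptws {poly rat} -> R}))).

Definition banach_of (mu : pseudonorms) : completeNormedModType R :=
  completion (ker_quot (extension mu)).

Definition finite_dimensional (E : lmodType R) : Prop :=
  exists (n : nat) (v : 'I_n -> E), forall x, exists a : 'I_n -> R,
    x = \sum_(i < n) a i *: v i.

Definition P_infinite : set pseudonorms :=
  [set mu | ~ finite_dimensional (banach_of mu)].

Definition P_norm : set pseudonorms :=
  [set mu | P_infinite mu /\ forall x, extension mu x = 0 -> x = 0].

Definition linearly_isometric (E F : normedModType R) : Prop :=
  exists T : {linear E -> F},
    (forall x, `|T x| = `|x|) /\ (forall y, exists x, T x = y).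

(* I carries the subspace topology, as the subtype set_type I. *)
Definition isometry_class (I : set pseudonorms) (X : normedModType R) : set I :=
  [set mu : I | linearly_isometric (banach_of (set_val mu)) X].

Definition separable (T : topologicalType) : Prop :=
  exists D : set T, countable D /\ dense D.

Definition K_isomorphism (K : R) (E F : normedModType R) (T : E -> F) : Prop :=
  linear T /\ forall x, K^-1 * `|x| <= `|T x| <= K * `|x|.

(* The embedding g of the subspace A is given by its values on A, and the
   operator norm of f \o g - id on A is unfolded. *)
Definition gurarii (G : completeNormedModType R) : Prop :=
  separable G /\
  forall (e : R) (B : completeNormedModType R) (A : {pred G}) (g : G -> B),
    0 < e -> finite_dimensional B -> submod_closed A ->
    (forall a : R, {in A &, forall x y, g (a *: x + y) = a *: g x + g y}) ->
    {in A, forall x, `|g x| = `|x|} ->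
    exists f : B -> G, K_isomorphism (1 + e) f /\
      {in A, forall x, `|f (g x) - x| <= e * `|x|}.

End pseudonorm_space.

Arguments P_infinite R : clear implicits.
Arguments P_norm R : clear implicits.
Arguments isometry_class {R} I X.

(* Main.v *)
(* Call a Banach space Y extendible if, given points x_0, ..., x_(n-1) of Y and a
   pseudonorm p on the finitely supported rational sequences that agrees on the
   first n coordinates with the pseudonorm induced by the x_i up to an l1-error
   delta, one can move the x_i by about delta and add further points of Y so as to
   realise p up to an arbitrarily small l1-error.

   The Gurarii space is extendible: an infimal convolution glues the span of the x_i
   and the space of p together with the x_i kept delta-close to their copies, and
   the Gurarii property is applied to the resulting finite dimensional space.
   A back-and-forth argument shows that separable extendible Banach spaces are
   isometric, so the isometry class of G is {mu | X_mu is extendible}.  On sequences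
   supported in the first N coordinates, pointwise closeness of pseudonorms is
   l1-uniform closeness; hence extendibility of X_mu need only be tested on a
   countable family of data, and each instance is an open condition on mu.

   For density, extendibility with n = 0 yields points of G that induce
   approximately mu on the first N coordinates.  Perturbing them to be linearly
   independent, and continuing with an independent sequence whose span is dense,
   gives norms close to mu whose completion is G. *)
From HB Require Import structures.
Require Import Defs.
From mathcomp Require Import all_boot all_order all_algebra.
From mathcomp Require Import mathcomp_extra boolp classical_sets functions cardinality reals.
From mathcomp Require Import topology normedtype sequences borel_hierarchy.
From mathcomp Require Import ring lra zify.

Set Implicit Arguments.
Unset Strict Implicit.
Unset Printing Implicit Defensive.

Import Order.TTheory GRing.Theory Num.Theory.
Import numFieldNormedType.Exports.

Local Open Scope classical_set_scope.
Local Open Scope ring_scope.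

(** * Linear combinations and the l1 norm *)

Local Notation toR := (map_poly ratr).

Section linear_combinations.
Context (K : fieldType) (X : lmodType K).
Implicit Types (x y : nat -> X) (A : {poly K}).

Definition lc x A : X := \sum_(i < size A) A`_i *: x i.

Lemma lcE n x A : (size A <= n)%N -> lc x A = \sum_(i < n) A`_i *: x i.
Proof.
move=> An; rewrite /lc (big_ord_widen n (fun i => A`_i *: x i) An) big_mkcond /=.
by apply: eq_bigr => i _; case: ltnP => // Ai; rewrite nth_default// scale0r.
Qed.

Lemma lc_linear x : linear (lc x).
Proof.
move=> a A B; pose n := maxn (size A) (size B).
have nA : (size (a *: A) <= n)%N by rewrite (leq_trans (size_scale_leq _ _))// leq_maxl.
rewrite (@lcE n _ (a *: A + B)); last first.
  by rewrite (leq_trans (size_polyD _ _))// geq_max nA leq_maxr.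
rewrite (@lcE n _ A) ?leq_maxl// (@lcE n _ B) ?leq_maxr// scaler_sumr -big_split.
by apply: eq_bigr => i _; rewrite coefD coefZ scalerDl scalerA.
Qed.
HB.instance Definition _ x :=
  GRing.isLinear.Build K {poly K} X *:%R (lc x) (lc_linear x).

Lemma lcD x A B : lc x (A + B) = lc x A + lc x B.
Proof. exact: linearD. Qed.

Lemma lcB x A B : lc x (A - B) = lc x A - lc x B.
Proof. exact: linearB. Qed.

Lemma lcZ x a A : lc x (a *: A) = a *: lc x A.
Proof. exact: linearZ. Qed.

Lemma lc_sum x (I : Type) (s : seq I) (F : I -> {poly K}) :
  lc x (\sum_(i <- s) F i) = \sum_(i <- s) lc x (F i).
Proof. exact: linear_sum. Qed.

Lemma lcXn x i : lc x 'X^i = x i.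
Proof.
rewrite /lc size_polyXn big_ord_recr /= coefXn eqxx scale1r big1 ?add0r// => j _.
by rewrite coefXn ltn_eqF// scale0r.
Qed.

Lemma eq_lc n x y A : (size A <= n)%N -> (forall i, (i < n)%N -> x i = y i) ->
  lc x A = lc y A.
Proof.
by move=> An xy; rewrite !(@lcE n)//; apply: eq_bigr => i _; rewrite xy.
Qed.

Lemma linear_lc (f : {linear {poly K} -> X}) A : f A = lc (fun i => f 'X^i) A.
Proof.
by rewrite -{1}(coefK A) poly_def linear_sum; apply: eq_bigr => i _; rewrite linearZ.
Qed.

End linear_combinations.

Lemma lc_comp (K : fieldType) (X Y : lmodType K) (f : {linear X -> Y}) x A :
  lc (fun i => f (x i)) A = f (lc x A).
Proof. by rewrite /lc linear_sum; apply: eq_bigr => i _; rewrite linearZ. Qed.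

Lemma lc_ratXn (R : realType) (X : lmodType R) (x : nat -> X) i :
  lc x (toR 'X^i) = x i.
Proof. by rewrite map_polyXn lcXn. Qed.

Section l1_norm.
Context (R : realType).
Implicit Types (a : {poly rat}) (p : pseudonorms R).

Definition l1 a : R := \sum_(i < size a) `|ratr a`_i|.

Lemma l1E n a : (size a <= n)%N -> l1 a = \sum_(i < n) `|ratr a`_i|.
Proof.
move=> an; rewrite /l1 (big_ord_widen n (fun i => `|ratr a`_i : R|) an) big_mkcond /=.
by apply: eq_bigr => i _; case: ltnP => // ai; rewrite nth_default// rmorph0 normr0.
Qed.

Lemma l1D a b : l1 (a + b) <= l1 a + l1 b.
Proof.
pose n := maxn (size a) (size b).
rewrite (@l1E n) ?size_polyD// (@l1E n a) ?leq_maxl// (@l1E n b) ?leq_maxr//.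
by rewrite -big_split ler_sum// => i _; rewrite coefD rmorphD ler_normD.
Qed.

Lemma l1Z c a : l1 (c *: a) = (ratr : {rmorphism rat -> R}) `|c| * l1 a.
Proof.
rewrite (@l1E (size a)) ?size_scale_leq// mulr_sumr; apply: eq_bigr => i _.
by rewrite coefZ rmorphM normrM /= ratr_norm.
Qed.

Definition l1_pn : pseudonorms R := Pseudonorm l1D l1Z.

Lemma l1_ge0 a : 0 <= l1 a.
Proof. exact: (pseudonorm_ge0 l1_pn). Qed.

Lemma l10 : l1 0 = 0.
Proof. exact: (pseudonorm0 l1_pn). Qed.

Lemma l1N a : l1 (- a) = l1 a.
Proof. exact: (pseudonormN l1_pn). Qed.

Lemma l1Xn i : l1 'X^i = 1.
Proof.
rewrite /l1 size_polyXn big_ord_recr /= coefXn eqxx rmorph1 normr1 big1 ?add0r// => j _.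
by rewrite coefXn ltn_eqF// rmorph0 normr0.
Qed.

(** On finitely many coordinates the triangle inequality bounds a pseudonorm by [l1] times its
    largest value on the basis vectors. This makes [l1] the yardstick for all error bounds below. *)
Lemma le_l1 n C p a : (size a <= n)%N -> (forall i, (i < n)%N -> p 'X^i <= C) ->
  p a <= C * l1 a.
Proof.
move=> an pC; rewrite -{1}(coefK a) poly_def (le_trans (pseudonorm_sum _ _ _))//.
rewrite /l1 mulr_sumr ler_sum// => i _; rewrite pseudonormZ /= ratr_norm mulrC.
by rewrite ler_wpM2r// pC// (leq_trans _ an).
Qed.

End l1_norm.
Arguments l1 {R}.
Arguments l1_pn {R}.

Section lc_pseudonorm.
Context (R : realType) (X : normedModType R).
Implicit Types (x y : nat -> X) (a : {poly rat}) (A : {poly R}).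

Lemma lc_normD x (A B : {poly R}) : `|lc x (A + B)| <= `|lc x A| + `|lc x B|.
Proof. by rewrite linearD ler_normD. Qed.

Lemma lc_normZ x (c : R) (A : {poly R}) :
  `|lc x (c *: A)| = (idfun : {rmorphism R -> R}) `|c| * `|lc x A|.
Proof. by rewrite linearZ normrZ. Qed.

Definition lc_real x := Pseudonorm (lc_normD x) (lc_normZ x).

Lemma lc_ratD x (a b : {poly rat}) :
  `|lc x (toR (a + b))| <= `|lc x (toR a)| + `|lc x (toR b)|.
Proof. by rewrite rmorphD lc_normD. Qed.

Lemma lc_ratZ x (c : rat) (a : {poly rat}) :
  `|lc x (toR (c *: a))| = (ratr : {rmorphism rat -> R}) `|c| * `|lc x (toR a)|.
Proof. by rewrite map_polyZ lc_normZ /= ratr_norm. Qed.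

Definition lc_pn x : pseudonorms R := Pseudonorm (lc_ratD x) (lc_ratZ x).

(** [lc_real x] restricts to [lc_pn x] on rational coefficients, so uniqueness of the extension
    applies. *)
Lemma extension_lc_pn x A : extension (lc_pn x) A = `|lc x A|.
Proof. by rewrite -(@extension_unique _ (lc_pn x) (lc_real x)). Qed.

Lemma lc_dist n C x y a : (size a <= n)%N ->
  (forall i, (i < n)%N -> `|x i - y i| <= C) ->
  `| `|lc x (toR a)| - `|lc y (toR a)| | <= C * l1 a.
Proof.
move=> an xyC; rewrite (le_trans (ler_dist_dist _ _))//.
have -> : lc x (toR a) - lc y (toR a) = lc (fun i => x i - y i) (toR a).
  by rewrite /lc -sumrB; apply: eq_bigr => i _; rewrite scalerBr.
by apply: (@le_l1 _ n C (lc_pn (fun i => x i - y i))) => // i ni; rewrite /= map_polyXn lcXn xyC.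
Qed.

End lc_pseudonorm.

(** * Isometries between completions *)

Section halves.
Context (R : realType).

Lemma half_pow_gt0 k : 0 < 2^-1 ^+ k :> R.
Proof. by rewrite exprn_gt0 ?invr_gt0. Qed.

Lemma half_pow_lt (e : R) : 0 < e -> exists k0, forall k, (k0 <= k)%N -> 2^-1 ^+ k < e.
Proof.
move=> e0; have h1 : `|2^-1 : R| < 1 by rewrite ger0_norm ?invr_ge0// invf_lt1 ?ltr1n.
have /fcvgrPdist_lt /(_ _ e0)[k0 _ H] := cvg_geometric 1 h1; exists k0 => k k0k.
by have := H k k0k; rewrite /= sub0r normrN mul1r ger0_norm ?ltW// half_pow_gt0.
Qed.

Lemma le_half_pow (C r : R) k0 : (forall k, (k0 <= k)%N -> r <= C * 2^-1 ^+ k) -> r <= 0.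
Proof.
move=> H; rewrite leNgt; apply/negP => r0.
have C0 : 0 < `|C| + 1 by rewrite ltr_pwDr.
have [k1 hk] := half_pow_lt (divr_gt0 r0 C0).
have := H _ (leq_maxl k0 k1); have := hk _ (leq_maxr k0 k1).
rewrite ltr_pdivlMr// => + rC; apply/negP; rewrite -leNgt (le_trans rC)// mulrC ler_wpM2l//.
  by rewrite ltW// half_pow_gt0.
by rewrite (le_trans (ler_norm _))// lerDl.
Qed.

Lemma half_pow_cauchy (X : completeNormedModType R) (u : nat -> X) (C : R) m :
  (forall k, (m <= k)%N -> `|u k.+1 - u k| <= C * 2^-1 ^+ k) ->
  exists l, forall k, (m <= k)%N -> `|l - u k| <= 2 * C * 2^-1 ^+ k.
Proof.
move=> uC.
have C0 : 0 <= C.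
  by rewrite -(pmulr_lge0 _ (half_pow_gt0 m)) (le_trans _ (uC _ (leqnn m))).
have tail k l : (m <= k)%N -> `|u (k + l)%N - u k| <= 2 * C * 2^-1 ^+ k.
  (* Keeping the subtracted term of the geometric sum is what lets the induction on [l] close. *)
  move=> mk; suff: `|u (k + l)%N - u k| <= 2 * C * (2^-1 ^+ k - 2^-1 ^+ (k + l)).
    move/le_trans; apply; rewrite ler_wpM2l ?mulr_ge0// gerBl.
    by rewrite ltW// half_pow_gt0.
  elim: l => [|l IH]; first by rewrite addn0 !subrr normr0 mulr0.
  rewrite addnS (le_trans (ler_distD (u (k + l)%N) _ _))//.
  have := uC (k + l)%N (leq_trans mk (leq_addr _ _)).
  rewrite exprS; move: IH; lra.
have /cauchy_cvgP/cvg_ex[l ul] : cauchy (u @ \oo).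
  apply/cauchyP => e e0.
  have C1 : 0 < 2 * C + 1 by rewrite ltr_pwDr// mulr_ge0.
  have [k0 hk] := half_pow_lt (divr_gt0 e0 C1).
  exists (u (maxn m k0)); exists (maxn m k0) => // k /= /subnKC <-.
  rewrite -ball_normE /= distrC (le_lt_trans (tail _ _ (leq_maxl _ _)))//.
  have := hk _ (leq_maxr m k0); rewrite ltr_pdivlMr//.
  by have := half_pow_gt0 (maxn m k0); nra.
exists l => k mk; rewrite distrC.
have : `|u k - u n| @[n --> \oo] --> `|u k - l|.
  by apply: cvg_norm; apply: cvgB => //; exact: cvg_cst.
move=> H; apply: (cvgr_to_le H); exists k => // n /= /subnKC <-.
by rewrite distrC tail.
Qed.

End halves.

Section isometry.
Context (R : realType).

(** Only the closure of the linear span has to be the whole space. *)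
Definition spans (X : normedModType R) (x : nat -> X) :=
  forall z e, 0 < e -> exists A, `|z - lc x A| < e.

(* The graph of the isometry sending each x i to y i. *)
Definition same_limit (X Y : normedModType R) (x : nat -> X) (y : nat -> Y) z w :=
  forall e, 0 < e -> exists A, `|z - lc x A| < e /\ `|w - lc y A| < e.

(** Combinations approximating [z] to within 2^-k have counterparts over [y] with equal mutual
    distances; these form a Cauchy sequence, and its limit is the partner of [z]. *)
Lemma same_limit_total (X : normedModType R) (Y : completeNormedModType R)
    (x : nat -> X) (y : nat -> Y) :
  (forall A, `|lc x A| = `|lc y A|) -> spans x ->
  forall z, exists w, same_limit x y z w.
Proof.
move=> xy sx z.
have /choice[A AP] k : exists A, `|z - lc x A| < 2^-1 ^+ k.
  by apply: sx; exact: half_pow_gt0.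
have [] := @half_pow_cauchy _ Y (fun k => lc y (A k)) 2 0.
  move=> k _; rewrite -lcB -xy lcB (le_trans (ler_distD z _ _))//.
  have := AP k; have := AP k.+1; rewrite exprS distrC.
  have := @half_pow_gt0 R k; lra.
move=> w wA; exists w => e e0.
have [k hk] := half_pow_lt (divr_gt0 e0 (@ltr0n R 4)).
exists (A k); have := hk k (leqnn _); have := AP k; have := wA k (leq0n _).
by split; lra.
Qed.

(** The relation [same_limit] preserves norms and is closed under linear combinations, hence
    single-valued. It is total from either side, so it is the graph of a surjective linear
    isometry. *)
Lemma isometric_lc (X Y : completeNormedModType R) (x : nat -> X) (y : nat -> Y) :
  (forall A, `|lc x A| = `|lc y A|) -> spans x -> spans y -> linearly_isometric X Y.
Proof.
move=> xy sx sy; have /choice[T TP] := same_limit_total xy sx.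
have sl_norm z w : same_limit x y z w -> `|z| = `|w|.
  move=> zw; apply/eqP; rewrite -subr_eq0 -normr_le0.
  apply/ler_addgt0Pr => e e0; rewrite add0r.
  have [A [zA wA]] := zw _ (divr_gt0 e0 (@ltr0n R 2)).
  rewrite (le_trans (ler_distD `|lc x A| _ _))// {2}xy [`| `|lc y A| - _|]distrC.
  have := ler_dist_dist z (lc x A); have := ler_dist_dist w (lc y A); lra.
have sl_lin a z w z' w' : same_limit x y z w -> same_limit x y z' w' ->
    same_limit x y (a *: z + z') (a *: w + w').
  move=> zw zw' e e0; have a1 : 0 < `|a| + 1 by rewrite ltr_pwDr.
  have e2 : 0 < e / 2 by rewrite divr_gt0.
  have [A [zA wA]] := zw _ (divr_gt0 e2 a1); have [B [zB wB]] := zw' _ e2.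
  have H (V : normedModType R) (u u' v v' : V) : `|u - v| < e / 2 / (`|a| + 1) ->
      `|u' - v'| < e / 2 -> `|a *: u + u' - (a *: v + v')| < e.
    rewrite ltr_pdivlMr// => uv uv'; rewrite opprD addrACA -scalerBr.
    rewrite (le_lt_trans (ler_normD _ _))// normrZ.
    by have := normr_ge0 (u - v); nra.
  by exists (a *: A + B); rewrite !lcD !lcZ; split; exact: H.
have sl_fun z w w' : same_limit x y z w -> same_limit x y z w' -> w = w'.
  move=> /(sl_lin (-1)) H /H; rewrite !scaleN1r addNr => /sl_norm/esym.
  by rewrite normr0 => /normr0_eq0 /eqP; rewrite addrC subr_eq0 => /eqP.
have Tlin : linear T by move=> a z z'; apply: sl_fun (TP _) (sl_lin _ _ _ _ _ _ _).
pose Tl := GRing.isLinear.Build R X Y *:%R T Tlin.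
pose T' : {linear X -> Y} := HB.pack T Tl.
exists T'; split=> [z|w]; first by rewrite (sl_norm _ _ (TP z)).
have yx A : `|lc y A| = `|lc x A| by [].
have [z wz] := same_limit_total yx sy w; exists z; apply: (sl_fun z _ _ (TP z)) => e e0.
by have [A []] := wz _ e0; exists A.
Qed.

End isometry.

(** * Finite dimensional spans *)

Section finite_dimension.
Context (R : realType).

Lemma poly_recr n (A : {poly R}) : (size A <= n.+1)%N ->
  A = take_poly n A + A`_n *: 'X^n.
Proof.
move=> An; apply/polyP => i; rewrite coefD coef_take_poly coefZ coefXn.
case: ltngtP => [||->]; rewrite ?mulr0 ?addr0 ?mulr1 ?add0r// => ni.
by rewrite nth_default// (leq_trans An).
Qed.

(** A finite dimensional subspace is closed. The induction isolates the coefficient of the last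
    vector and applies the hypothesis to what remains. *)
Lemma fin_span_closed (X : completeNormedModType R) (x : nat -> X) n z :
  (forall e, 0 < e -> exists A : {poly R}, (size A <= n)%N /\ `|z - lc x A| < e) ->
  exists A : {poly R}, (size A <= n)%N /\ z = lc x A.
Proof.
elim: n z => [|n IH] z zA.
  exists 0; rewrite size_poly0; split => //; apply/eqP; rewrite -subr_eq0 -normr_le0.
  apply/ler_addgt0Pr => e /zA[A [A0]]; rewrite add0r => /ltW.
  by move: A0; rewrite leqn0 size_poly_eq0 => /eqP ->.
have zn : exists t, forall e, 0 < e ->
    exists A : {poly R}, (size A <= n)%N /\ `|z - t *: x n - lc x A| < e.
  have [[B [Bn xB]]|xn] := pselect (exists A : {poly R}, (size A <= n)%N /\ x n = lc x A).
    exists 0 => e /zA[A [An zAe]]; exists (take_poly n A + A`_n *: B); split.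
      rewrite (leq_trans (size_polyD _ _))// geq_max size_take_poly.
      by rewrite (leq_trans (size_scale_leq _ _)).
    by rewrite scale0r subr0 lcD lcZ -xB -(lcXn x n) -lcZ -lcD -poly_recr.
  (* If [x n] had distance 0 from the span of its predecessors, the induction hypothesis would put
     it in that span. *)
  have [d d0 xd] : exists2 d, 0 < d & forall A : {poly R}, (size A <= n)%N -> d <= `|x n - lc x A|.
    apply: contrapT => H; apply: xn; apply: IH => e e0; apply: contrapT => He.
    apply: H; exists e => // A An; rewrite leNgt; apply/negP => xA.
    by apply: He; exists A.
  have /choice[A AP] k : exists A : {poly R}, (size A <= n.+1)%N /\ `|z - lc x A| < 2^-1 ^+ k.
    by apply: zA; exact: half_pow_gt0.
  (* Two approximants whose [n]-th coefficients differ by [t] are at least [|t| * d] apart, and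
     consecutive ones are within 2 * 2^-k; so these coefficients converge. *)
  have [] := @half_pow_cauchy R R^o (fun k => (A k)`_n) (2 / d) 0.
    move=> k _; set t := _ - _; have [->|t0] := eqVneq t 0.
      by rewrite normr0 mulr_ge0 ?divr_ge0 ?ltW// half_pow_gt0.
    rewrite mulrAC ler_pdivlMr//.
    have At : A k.+1 - A k = t *: 'X^n + take_poly n (A k.+1 - A k).
      rewrite [RHS]addrC [LHS](@poly_recr n) ?coefB//.
      by rewrite (leq_trans (size_polyD _ _))// size_polyN geq_max !(AP _).1.
    have : `|t| * d <= `|lc x (A k.+1 - A k)|.
      rewrite At lcD lcZ lcXn -[lc x (take_poly _ _)](scalerKV t0).
      rewrite -scalerDr normrZ ler_wpM2l//.
      rewrite -[_^-1 *: _]opprK -scaleNr -lcZ xd//.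
      by rewrite (leq_trans (size_scale_leq _ _))// size_take_poly.
    move/le_trans; apply; rewrite lcB (le_trans (ler_distD z _ _))//.
    have := (AP k).2; have := (AP k.+1).2; rewrite exprS distrC.
    have := @half_pow_gt0 R k; lra.
  move=> t tA; exists t => e e0.
  have C0 : 0 < 2 * (2 / d) * `|x n| + 1.
    by rewrite ltr_pwDr// mulr_ge0// mulr_ge0// divr_ge0// ltW.
  have [k hk] := half_pow_lt (divr_gt0 e0 C0).
  exists (take_poly n (A k)); split; first exact: size_take_poly.
  have -> : z - t *: x n - lc x (take_poly n (A k)) =
      (z - lc x (A k)) - (t - (A k)`_n) *: x n.
    rewrite {2}(@poly_recr n (A k)) ?(AP k).1// lcD lcZ lcXn scalerBl.
    by rewrite opprB opprD !addrA subrK addrAC.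
  rewrite (le_lt_trans (ler_normB _ _))// normrZ.
  have := hk k (leqnn _); rewrite ltr_pdivlMr//.
  have := (AP k).2; have := tA k (leq0n _); have := normr_ge0 (x n).
  by set u := `|z - _|; set v := `|t - _|; nra.
have [t /IH[A [An zt]]] := zn; exists (A + t *: 'X^n); split.
  rewrite (leq_trans (size_polyD _ _))// geq_max (leq_trans An)//=.
  by rewrite (leq_trans (size_scale_leq _ _))// size_polyXn.
by rewrite lcD lcZ lcXn -zt subrK.
Qed.

End finite_dimension.

(** * The canonical basis of X_mu *)

Section canonical_basis.
Context (R : realType) (mu : pseudonorms R).

Definition basis_vec i : banach_of mu := to_completion (to_quot (extension mu) 'X^i).

Lemma lc_basis_vec A : lc basis_vec A = to_completion (to_quot (extension mu) A).
Proof.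
by have /= -> := linear_lc
  ((@to_completion R _ \o to_quot (extension mu)) : {linear _ -> banach_of mu}) A.
Qed.

Lemma norm_lc_basis_vec A : `|lc basis_vec A| = extension mu A.
Proof. by rewrite lc_basis_vec norm_to_completion norm_to_quot. Qed.

Lemma norm_lc_basis_vec_rat a : `|lc basis_vec (toR a)| = mu a.
Proof. by rewrite norm_lc_basis_vec extensionE. Qed.

Lemma spans_basis_vec : spans basis_vec.
Proof.
move=> z e e0; have [q zq] := to_completion_dense z e0.
by exists (of_quot q); rewrite lc_basis_vec of_quotK.
Qed.

(** All combinations agree in X_mu with their truncations, so the first [n] basis vectors have dense
    span, and this span is closed. *)
Lemma finite_dimensional_banach_of n :
  (forall i, (n <= i)%N -> mu 'X^i = 0) -> finite_dimensional (banach_of mu).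
Proof.
move=> mu0; exists n, (fun i : 'I_n => basis_vec i) => z.
have lc_take A : lc basis_vec A = lc basis_vec (take_poly n A).
  apply/eqP; rewrite -subr_eq0 -lcB; apply/eqP; apply: big1 => i _.
  rewrite coefB coef_take_poly; case: ltnP => [|ni]; first by rewrite subrr scale0r.
  apply/eqP; rewrite scaler_eq0 -(lcXn basis_vec i) -[_ == 0 :> banach_of _]normr_eq0.
  by rewrite -(map_polyXn ratr) norm_lc_basis_vec_rat mu0// eqxx orbT.
have [|A [An ->]] := @fin_span_closed _ _ basis_vec n z; last first.
  by exists (fun i => A`_i); exact: lcE.
move=> e /(spans_basis_vec z)[A zA]; exists (take_poly n A).
by rewrite -lc_take size_take_poly.
Qed.

End canonical_basis.

(** * The extension property of the Gurarii space *)

Section gurarii_extension.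
Context (R : realType).

(** This is extendibility: [delta] is the error of the given data and [eta] that of the result. When
    [n < N], the entries of [z] from [n] on are the added points. *)
Definition extension_property (Y : normedModType R) :=
  forall n N (x : nat -> Y) (p : pseudonorms R) (delta eta : R),
    0 <= delta -> 0 < eta ->
    (forall a : {poly rat}, (size a <= n)%N -> `|p a - `|lc x (toR a)| | <= delta * l1 a) ->
  exists z, (forall i, (i < n)%N -> `|z i - x i| <= delta + eta) /\
    forall a : {poly rat}, (size a <= N)%N -> `| `|lc z (toR a)| - p a| <= eta * l1 a.

(** Minimising a pseudonorm of two variables over the second leaves a pseudonorm in the first. The
    two conclusions characterise it as a greatest lower bound. *)
Lemma inf_pseudonorm (Q : {poly rat} -> {poly rat} -> R) :
  (forall c w, 0 <= Q c w) ->
  (forall c w c' w', Q (c + c') (w + w') <= Q c w + Q c' w') ->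
  (forall t c w, Q (t *: c) (t *: w) = `|ratr t| * Q c w) ->
  exists P : pseudonorms R, (forall c w, P c <= Q c w) /\
    forall c r, (forall w, r <= Q c w) -> r <= P c.
Proof.
move=> Q0 QD QZ; pose P c := inf [set Q c w | w in [set: {poly rat}]].
have P_le c w : P c <= Q c w.
  apply: ge_inf; last by exists w.
  by exists 0 => _ [v _ <-]; exact: Q0.
have le_P c r : (forall w, r <= Q c w) -> r <= P c.
  by move=> H; apply: lb_le_inf => [|_ [w _ <-]//]; exists (Q c 0), 0.
have PD c d : P (c + d) <= P c + P d.
  rewrite -lerBlDr; apply: (le_P) => v; rewrite lerBlDr -lerBlDl.
  by apply: (le_P) => w; rewrite lerBlDl (le_trans (P_le _ (v + w))).
(* For invertible [t] one inequality suffices: applied to the inverse of [t] it gives the other. *)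
have PZ_le t c : t != 0 -> P (t *: c) <= `|ratr t| * P c.
  move=> t0; rewrite -ler_pdivrMl ?normr_gt0 ?fmorph_eq0//; apply: (le_P) => w.
  by rewrite ler_pdivrMl ?normr_gt0 ?fmorph_eq0// -QZ.
have PZ t c : P (t *: c) = (ratr : {rmorphism rat -> R}) `|t| * P c.
  rewrite /= ratr_norm; have [->|t0] := eqVneq t 0.
    rewrite rmorph0 normr0 mul0r scale0r; apply/eqP; rewrite eq_le le_P// andbT.
    by rewrite (le_trans (P_le 0 0))// -{2}(scale0r 0) -(scale0r 0) QZ rmorph0 normr0 mul0r.
  apply/eqP; rewrite eq_le PZ_le// -ler_pdivlMl ?normr_gt0 ?fmorph_eq0//=.
  by rewrite -normfV -fmorphV -{1}[c](scalerK t0) PZ_le// invr_eq0.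
by exists (Pseudonorm (iota := (ratr : {rmorphism rat -> R})) PD PZ).
Qed.

(* The coordinates below n carry the norm of the span of x, those from n on carry
   p; identifying them at the price delta keeps both norms as soon as they agree
   up to delta. *)
Lemma amalgam (Y : normedModType R) n N (x : nat -> Y) (p : pseudonorms R) (delta : R) :
  0 <= delta ->
  (forall a : {poly rat}, (size a <= n)%N -> `|p a - `|lc x (toR a)| | <= delta * l1 a) ->
  exists P : pseudonorms R,
    [/\ forall a : {poly rat}, (size a <= n)%N -> P a = `|lc x (toR a)|,
        forall a : {poly rat}, (size a <= N)%N -> P ('X^n * a) = p a,
        forall i, (i < n)%N -> P ('X^(n + i) - 'X^i) <= delta &
        exists m, forall i, (m <= i)%N -> P 'X^i = 0].
Proof.
move=> delta0 px; pose M := maxn n N.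
(* The vector [w] is moved from the block of [x] to the block of [p] at cost [delta * l1 w].
   Truncating at [M] makes the result vanish on all late basis vectors, so that its completion is
   finite dimensional. *)
pose Q c w := `|lc x (toR (take_poly n c - take_poly n w))| +
  p (take_poly M (drop_poly n c) + take_poly n w) + delta * l1 (take_poly n w).
have [||| P [P_le le_P]] := @inf_pseudonorm Q.
- by move=> c w; rewrite !addr_ge0 ?pseudonorm_ge0 ?mulr_ge0 ?l1_ge0.
- move=> c w c' w'; rewrite /Q !(take_polyD, drop_polyD) opprD addrACA.
  rewrite (addrACA (take_poly M _)) [leRHS]addrACA -mulrDr lerD//.
    rewrite [leRHS]addrACA lerD//; last exact: pseudonormD.
    exact: (pseudonormD (lc_pn x)).
  by rewrite ler_wpM2l// l1D.
- move=> t c w; rewrite /Q !(take_polyZ, drop_polyZ) -scalerBr -scalerDr.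
  rewrite pseudonormZ l1Z /= -(ratr_norm R t) !mulrDr [delta * _]mulrCA.
  by rewrite -[`|lc _ _|]/(lc_pn x _) pseudonormZ.
have takeK k (a : {poly rat}) : (size a <= k)%N -> take_poly k a = a.
  by move=> ak; rewrite take_poly_id.
exists P; split.
- move=> a an; apply/eqP; rewrite eq_le; apply/andP; split.
    rewrite (le_trans (P_le a 0))// /Q takeK// drop_poly_eq0// !take_poly0r.
    by rewrite subr0 addr0 pseudonorm0 l10 mulr0 !addr0.
  (* Moving [w] saves nothing: by hypothesis its norm over [x] is at most [p w + delta * l1 w]. *)
  apply: (le_P) => w; rewrite /Q (takeK n a)// drop_poly_eq0// take_poly0r add0r.
  have := px _ (size_take_poly n w); rewrite ler_norml => /andP[+ _].
  have := pseudonormD (lc_pn x) (a - take_poly n w) (take_poly n w).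
  rewrite subrK /=; lra.
- move=> a aN; have take0 : take_poly n ('X^n * a) = 0.
    by apply/polyP => i; rewrite coef_take_poly coefXnM coef0; case: ltnP.
  have drop : drop_poly n ('X^n * a) = a by rewrite mulrC drop_polyMXn_id.
  have aM : (size a <= M)%N by rewrite (leq_trans aN)// leq_maxr.
  apply/eqP; rewrite eq_le; apply/andP; split.
    rewrite (le_trans (P_le _ 0))// /Q take0 drop (takeK M)// take_poly0r subrr.
    by rewrite rmorph0 linear0 normr0 addr0 l10 mulr0 addr0 add0r.
  apply: (le_P) => w; rewrite /Q take0 drop (takeK M)// sub0r.
  have := px _ (size_take_poly n w); rewrite ler_norml => /andP[_ +].
  have := pseudonormD p (a + take_poly n w) (- take_poly n w).
  rewrite addrK (pseudonormN p).
  by have /= -> := pseudonormN (lc_pn x) (take_poly n w); lra.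
(* Moving minus the [i]-th basis vector cancels both norm terms and leaves only the cost [delta]. *)
- move=> i ni; rewrite (le_trans (P_le _ (- 'X^i)))// /Q.
  have tX k : (i < k)%N -> take_poly k 'X^i = 'X^i :> {poly rat}.
    by move=> ik; rewrite takeK// size_polyXn.
  have -> : take_poly n ('X^(n + i) - 'X^i) = - 'X^i :> {poly rat}.
    rewrite linearB /= tX// (_ : take_poly n _ = 0) ?sub0r//.
    apply/polyP => j; rewrite coef_take_poly coefXn coef0.
    by case: ltnP => // jn; rewrite ltn_eqF// (leq_trans jn)// leq_addr.
  have -> : take_poly n (- 'X^i) = - 'X^i :> {poly rat} by rewrite linearN /= tX.
  have -> : take_poly M (drop_poly n ('X^(n + i) - 'X^i)) = 'X^i :> {poly rat}.
    rewrite linearB /= [drop_poly n 'X^i]drop_poly_eq0 ?size_polyXn//.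
    by rewrite subr0 addnC exprD drop_polyMXn_id tX// leq_max ni.
  by rewrite !subrr rmorph0 linear0 normr0 pseudonorm0 !add0r l1N l1Xn mulr1.
- exists (n + M)%N => i ni; apply/eqP; rewrite eq_le pseudonorm_ge0 andbT.
  rewrite (le_trans (P_le _ 0))// /Q take_poly0r.
  have -> : take_poly n 'X^i = 0 :> {poly rat}.
    apply/polyP => j; rewrite coef_take_poly coefXn coef0.
    by case: ltnP => // ?; rewrite ltn_eqF//; lia.
  have -> : take_poly M (drop_poly n 'X^i) = 0 :> {poly rat}.
    apply/polyP => j; rewrite coef_take_poly coef_drop_poly coefXn coef0.
    by case: ltnP => // ?; rewrite ltn_eqF//; lia.
  by rewrite subr0 addr0 rmorph0 linear0 normr0 !pseudonorm0 l10 mulr0 !addr0.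
Qed.

Lemma eq_norm_lc (X Y : normedModType R) (x : nat -> X) (y : nat -> Y) :
  (forall a, `|lc x (toR a)| = `|lc y (toR a)|) -> forall A, `|lc x A| = `|lc y A|.
Proof.
move=> xy A; rewrite -extension_lc_pn; apply/esym.
by apply: (@extension_unique _ _ (lc_real y)) => a /=; rewrite xy.
Qed.

Lemma lc_take (X : lmodType R) n (x : nat -> X) A :
  lc (fun i => if (i < n)%N then x i else 0) A = lc x (take_poly n A).
Proof.
pose k := maxn n (size A); rewrite !(@lcE _ _ k) ?leq_maxr//; last first.
  by rewrite (leq_trans (size_take_poly _ _))// leq_maxl.
apply: eq_bigr => i _; rewrite coef_take_poly.
by case: ifP; rewrite ?scaler0 ?scale0r.
Qed.

(** Replacing the vectors from [n] on by 0 reduces this to [eq_norm_lc]. *)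
Lemma eq_norm_lc_size n (X Y : normedModType R) (x : nat -> X) (y : nat -> Y) :
  (forall a : {poly rat}, (size a <= n)%N -> `|lc x (toR a)| = `|lc y (toR a)|) ->
  forall A : {poly R}, (size A <= n)%N -> `|lc x A| = `|lc y A|.
Proof.
move=> xy A An; rewrite -(take_poly_id An) -!lc_take; apply: eq_norm_lc => a.
have take_toR : take_poly n (toR a) = toR (take_poly n a) :> {poly R}.
  apply/polyP => i; rewrite !(coef_take_poly, coef_map) /=.
  by case: ifP; rewrite ?rmorph0.
by rewrite !lc_take take_toR xy ?size_take_poly.
Qed.

(** The Gurarii property is applied to the completion of the amalgam, with the span of the [x i]
    embedded through its first block; the image of the second block realises [p]. *)
Lemma gurarii_extension_property (G : completeNormedModType R) :
  gurarii G -> extension_property G.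
Proof.
move=> [_ gG] n N x p delta eta delta0 eta0 px.
have [P [Pn PN Pni [m Pm]]] := amalgam N delta0 px.
pose e := basis_vec P.
have ex : forall A : {poly R}, (size A <= n)%N -> `|lc e A| = `|lc x A|.
  by apply: eq_norm_lc_size => a an; rewrite norm_lc_basis_vec_rat Pn.
pose S : {pred G} := fun z => `[< exists A : {poly R}, (size A <= n)%N /\ z = lc x A >].
have /choice[rep repP] z : exists A : {poly R}, z \in S -> (size A <= n)%N /\ z = lc x A.
  have [/asboolP[A AP]|] := boolP (z \in S); first by exists A.
  by exists 0.
have SX (A : {poly R}) : (size A <= n)%N -> lc x A \in S by move=> An; apply/asboolP; exists A.
(* Coefficients over [x] need not be unique, but two choices differ by a combination of norm 0 over
   [x], hence over [e], so [g] is well defined. *)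
pose g z := lc e (rep z).
have gE (A : {poly R}) : (size A <= n)%N -> g (lc x A) = lc e A.
  move=> An; have [rn rE] := repP _ (SX _ An).
  apply/eqP; rewrite -subr_eq0 -normr_eq0 -lcB ex.
    by rewrite lcB -rE subrr normr0.
  by rewrite (leq_trans (size_polyD _ _))// geq_max size_polyN rn.
pose Cp := \sum_(i < N) p 'X^i; pose Cx := \sum_(i < n) `|x i|.
have Cp0 : 0 <= Cp by apply: sumr_ge0 => i _; exact: pseudonorm_ge0.
have Cx0 : 0 <= Cx by apply: sumr_ge0.
have K0 : 0 < delta + Cx + Cp + 1 by rewrite ltr_pwDr// !addr_ge0.
(* Small enough that relative errors [eps] on vectors of norm at most [delta], [Cx] or [Cp] total at
   most [eta]. *)
pose eps := eta / (delta + Cx + Cp + 1).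
have eps0 : 0 < eps by rewrite divr_gt0.
have epsK : eps * (delta + Cx + Cp + 1) = eta by rewrite divfK// gt_eqF.
have Xn i : (i < n)%N -> (size ('X^i : {poly R}) <= n)%N by rewrite size_polyXn.
have [||||f [[flin fK] fg]] := gG eps (banach_of P) S g eps0.
- exact: finite_dimensional_banach_of Pm.
- split; first by rewrite -(linear0 (lc x)) SX// size_poly0.
  move=> a u v /repP[un uE] /repP[vn vE]; rewrite uE vE -lcZ -lcD SX//.
  rewrite (leq_trans (size_polyD _ _))// geq_max vn andbT.
  by rewrite (leq_trans (size_scale_leq _ _)).
- move=> a u v /repP[un uE] /repP[vn vE]; rewrite {1}uE {1}vE -lcZ -lcD gE ?lcD ?lcZ//.
  rewrite (leq_trans (size_polyD _ _))// geq_max vn andbT.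
  by rewrite (leq_trans (size_scale_leq _ _)).
- by move=> u /repP[un uE]; rewrite ex// -uE.
pose f' : {linear banach_of P -> G} :=
  HB.pack f (GRing.isLinear.Build R (banach_of P) G *:%R f flin).
have fK' b : `| `|f b| - `|b| | <= eps * `|b|.
  have /andP[h1 h2] := fK b; have b0 := normr_ge0 b.
  rewrite ler_norml; apply/andP; split; last by lra.
  suff: (1 - eps) * `|b| <= (1 + eps)^-1 * `|b| by lra.
  by rewrite ler_wpM2r// -div1r ler_pdivlMr ?addr_gt0//; nra.
exists (fun i => f (e (n + i)%N)); split=> [i ni|a aN].
  (* The displacement of [x i] is the image under [f] of the difference of its two copies, of norm
     at most [delta], plus the error of [f] inverting [g]. *)
  have -> : x i = f (g (x i)) - (f (g (x i)) - x i) by rewrite subKr.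
  rewrite opprB addrC addrAC -addrA.
  have -> : f (e (n + i)%N) - f (g (x i)) = f (e (n + i)%N - e i).
    by rewrite -[f (g _)]/(f' _) -[f (e _)]/(f' _) -linearB -{1}(lcXn x i) gE ?Xn// lcXn.
  rewrite (le_trans (ler_normD _ _))//.
  have xS : x i \in S by rewrite -(lcXn x i) SX// Xn.
  have := fg _ xS; have := (andP (fK (e (n + i)%N - e i))).2.
  have : `|e (n + i)%N - e i| <= delta.
    by rewrite -!(lc_ratXn e) -lcB -rmorphB norm_lc_basis_vec_rat Pni.
  have : `|x i| <= Cx by rewrite /Cx (bigD1 (Ordinal ni))//= lerDl sumr_ge0.
  have := normr_ge0 (x i); have := normr_ge0 (e (n + i)%N - e i).
  move: epsK; set u := `|f (g _) - _|; set v := `|f _|; nra.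
(* Multiplication by ['X^n] shifts coefficients into the second block. *)
have -> : lc (fun i => f (e (n + i)%N)) (toR a) = f (lc e (toR ('X^n * a))).
  rewrite (lc_comp f') -[RHS]/(f' _); congr (f' _).
  have aE : (size ('X^n * toR a : {poly R})%R <= n + size (toR a : {poly R}))%N.
    by rewrite (leq_trans (size_polyMleq _ _))// size_polyXn.
  rewrite rmorphM /= map_polyXn (lcE e aE) big_split_ord /=.
  rewrite big1 ?add0r => [|i _]; last by rewrite coefXnM ltn_ord scale0r.
  by apply: eq_bigr => i _; rewrite coefXnM ltnNge leq_addr /= addKn.
rewrite -(PN a aN) -norm_lc_basis_vec_rat (le_trans (fK' _))//.
rewrite norm_lc_basis_vec_rat PN//.
have pC : p a <= Cp * l1 a.
  apply: le_l1 aN _ => i iN; rewrite /Cp (bigD1 (Ordinal iN))//= lerDl sumr_ge0// => j _.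
  exact: pseudonorm_ge0.
rewrite -epsK -mulrA ler_wpM2l ?(ltW eps0)//.
by rewrite (le_trans pC)// ler_wpM2r ?l1_ge0//; lra.
Qed.

End gurarii_extension.

(** * Back and forth *)

(** Dependent choice with a stage-indexed invariant; [s0] is the default successor where the
    invariant fails. *)
Lemma iterated_choice (T : Type) (Inv : nat -> T -> Prop) (step : nat -> T -> T -> Prop) s0 :
  Inv 0%N s0 ->
  (forall k s, Inv k s -> exists s', step k s s' /\ Inv k.+1 s') ->
  exists u : nat -> T, forall k, Inv k (u k) /\ step k (u k) (u k.+1).
Proof.
move=> s00 H.
have /choice[F FP] (ks : nat * T) : exists s', Inv ks.1 ks.2 ->
    step ks.1 ks.2 s' /\ Inv ks.1.+1 s'.
  have [/H[s' Hs']|] := pselect (Inv ks.1 ks.2); first by exists s'.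
  by exists s0.
pose u k := nat_rect (fun=> T) s0 (fun k s => F (k, s)) k.
have uInv k : Inv k (u k) by elim: k => [//|k IH]; exact: (FP (k, u k) IH).2.
by exists u => k; split=> //; exact: (FP (k, u k) (uInv k)).1.
Qed.

Section back_and_forth.
Context (R : realType).

(** Approximants must occur at arbitrarily late indices, where the errors of a construction by
    stages are already small. *)
Definition dense_seq (X : normedModType R) (d : nat -> X) :=
  forall z e m, 0 < e -> exists k, (m <= k)%N /\ `|d k - z| < e.

Definition almost_isometric (X Y : normedModType R) (delta : R) n
    (x : nat -> X) (y : nat -> Y) :=
  forall a : {poly rat}, (size a <= n)%N ->
    `| `|lc x (toR a)| - `|lc y (toR a)| | <= delta * l1 a.

Lemma almost_isometricC (X Y : normedModType R) delta n (x : nat -> X) (y : nat -> Y) :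
  almost_isometric delta n x y -> almost_isometric delta n y x.
Proof. by move=> xy a an; rewrite distrC xy. Qed.

Lemma extend_almost_isometry (X Y : normedModType R) delta eta n
    (x : nat -> X) (y : nat -> Y) d :
  extension_property Y -> 0 <= delta -> 0 < eta -> almost_isometric delta n x y ->
  exists y', (forall i, (i < n)%N -> `|y' i - y i| <= delta + eta) /\
    almost_isometric eta n.+1 (fun i => if i == n then d else x i) y'.
Proof.
move=> eY delta0 eta0 xy; pose x' i := if i == n then d else x i.
have [a an|y' [yy' xy']] := eY n n.+1 y (lc_pn x') delta eta delta0 eta0.
  rewrite /= (@eq_lc _ _ n x' x) ?xy// ?size_map_poly// => i ni.
  by rewrite /x' ltn_eqF.
by exists y'; split => // a an; rewrite distrC xy'.
Qed.

(** Stage [k] holds [2 * k] vectors on each side, matched up to 2^-k. The next stage inserts [d k]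
    in X, then [f k] in Y, moving old vectors by at most 2 * 2^-k; the coordinatewise limits are
    isometrically matched and span both spaces densely. *)
Lemma back_and_forth (X Y : completeNormedModType R) (d : nat -> X) (f : nat -> Y) :
  extension_property X -> extension_property Y -> dense_seq d -> dense_seq f ->
  linearly_isometric X Y.
Proof.
move=> eX eY dX fY.
pose h k : R := 2^-1 ^+ k; have h0 k : 0 < h k := half_pow_gt0 R k.
have hS k : h k.+1 = h k / 2 by rewrite /h exprS mulrC.
pose Inv k (s : (nat -> X) * (nat -> Y)) := almost_isometric (h k) k.*2 s.1 s.2.
pose close (Z : normedModType R) k (z z' : nat -> Z) :=
  forall i, (i < k.*2)%N -> `|z' i - z i| <= 2 * h k.
pose step k (s s' : (nat -> X) * (nat -> Y)) :=
  [/\ close X k s.1 s'.1, close Y k s.2 s'.2,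
      `|s'.1 k.*2 - d k| <= 2 * h k & `|s'.2 k.*2.+1 - f k| <= 2 * h k].
have [|k [x y] xy|u uP] := @iterated_choice _ Inv step (fun=> 0, fun=> 0).
- move=> a; rewrite leqn0 size_poly_eq0 => /eqP ->.
  by rewrite rmorph0 !linear0 !normr0 subrr normr0 l10 mulr0.
- have [y' [yy' xy']] := extend_almost_isometry (d k) eY (ltW (h0 k)) (h0 k.+1) xy.
  have [x' [xx' x'y']] := extend_almost_isometry (f k) eX (ltW (h0 k.+1)) (h0 k.+1)
    (almost_isometricC xy').
  exists (x', fun i => if i == k.*2.+1 then f k else y' i); split; last exact: almost_isometricC.
  have hk := h0 k; split => [i ik|i ik||] /=.
  + have := xx' i (leqW ik); rewrite ltn_eqF// hS; lra.
  + by rewrite ltn_eqF ?(leqW ik)//; have := yy' i ik; rewrite hS; lra.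
  + by have := xx' k.*2 (leqnn _); rewrite eqxx hS; lra.
  + by rewrite eqxx subrr normr0; lra.
have lim (Z : completeNormedModType R) (v : nat -> nat -> Z) :
    (forall k, close Z k (v k) (v k.+1)) ->
    exists l, forall i k, (i < k.*2)%N -> `|l i - v k i| <= 4 * h k.
  move=> vP; suff /choice[l lP] : forall i, exists l, forall k, (i < k.*2)%N ->
      `|l - v k i| <= 4 * h k by exists l.
  (* Coordinate [i] is controlled only from stage [i./2.+1] on, the first with [i < k.*2]. *)
  move=> i; have [] := @half_pow_cauchy _ Z (fun k => v k i) 2 i./2.+1.
    by move=> k; rewrite ltn_half_double; exact: vP.
  by move=> l lP; exists l => k; rewrite -ltn_half_double => /lP; rewrite -natrM.
have [x xP] := lim X (fun k => (u k).1) (fun k => let: conj _ (And4 ux _ _ _) := uP k in ux).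
have [y yP] := lim Y (fun k => (u k).2) (fun k => let: conj _ (And4 _ uy _ _) := uP k in uy).
have spansP (Z : normedModType R) (g z : nat -> Z) j : (forall k, (j k < k.+1.*2)%N) ->
    dense_seq g -> (forall k, `|z (j k) - g k| <= 4 * h k) -> spans z.
  move=> jk gZ zg w e e0; have [k0 hk0] := half_pow_lt (divr_gt0 e0 (@ltr0n R 8)).
  have [k [k0k gw]] := gZ w _ k0 (divr_gt0 e0 (@ltr0n R 2)).
  exists 'X^(j k); rewrite lcXn distrC (le_lt_trans (ler_distD (g k) _ _))//.
  have := zg k; have := hk0 k k0k; rewrite -/(h k); lra.
apply: (@isometric_lc _ X Y x y).
- apply: eq_norm_lc => a; apply/eqP; rewrite -subr_eq0 -normr_le0.
  (* The 9 is 4 for each passage to the limit and 1 for the matching at stage [k]. *)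
  apply: (@le_half_pow _ (9 * l1 a) _ (size a)) => k ak.
  have ak2 : (size a <= k.*2)%N by rewrite (leq_trans ak)// -addnn leq_addr.
  have := (uP k).1 a ak2.
  have := lc_dist ak2 (fun i => xP i k); have := lc_dist ak2 (fun i => yP i k).
  rewrite -/(h k) !ler_norml => /andP[? ?] /andP[? ?] /andP[? ?].
  by apply/andP; split; lra.
- apply: (spansP X d x double) => // k.
  have [_ [_ _ + _]] := uP k; have := xP k.*2 k.+1; rewrite ltn_double ltnSn hS => /(_ isT).
  move=> H1 H2; rewrite (le_trans (ler_distD ((u k.+1).1 k.*2) _ _))//; lra.
- apply: (spansP Y f y (fun k => k.*2.+1)) => // k.
  have [_ [_ _ _]] := uP k; have := yP k.*2.+1 k.+1; rewrite doubleS ltnSn hS => /(_ isT).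
  move=> H1 H2; rewrite (le_trans (ler_distD ((u k.+1).2 k.*2.+1) _ _))//; lra.
Qed.

End back_and_forth.

(** * The topology of pseudonorms *)

Section pointwise_topology.
Context (R : realType).
Implicit Types (mu nu : pseudonorms R) (v : {poly rat}).

#[local] Instance nbhs_pseudonorms_filter mu : ProperFilter (nbhs mu).
Proof. exact: nbhs_pfilter. Qed.

Lemma eval_continuous v : continuous (fun nu : pseudonorms R => nu v).
Proof.
move=> mu; apply: (@continuous_comp (pseudonorms R) {ptws {poly rat} -> R} R
  (fun nu => nu : {poly rat} -> R) (@proj {poly rat} (fun=> R) v)).
  exact: (@initial_continuous _ {ptws {poly rat} -> R}
    (fun nu : pseudonorms R => (nu : {poly rat} -> R))).
exact: proj_continuous.
Qed.

Lemma nbhs_eval mu v e : 0 < e -> nbhs mu [set nu : pseudonorms R | `|nu v - mu v| < e].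
Proof.
move=> e0; have /fcvgrPdist_lt /(_ _ e0) H := @eval_continuous v mu.
have {H} : nbhs mu [set nu : pseudonorms R | `|mu v - nu v| < e] by exact: H.
by apply: filterS => nu /=; rewrite distrC.
Qed.

(** Open sets are traces of open sets of the function space, whose topology is the supremum of those
    induced by the evaluations. *)
Lemma cvg_pseudonorms (u : nat -> pseudonorms R) mu :
  (forall v, (fun k => u k v) @ \oo --> mu v) -> u @ \oo --> mu.
Proof.
move=> uv O; rewrite /= nbhsE => -[_ [[B oB <-] Bmu] BO].
have : (fun k => u k : {poly rat} -> R) @ \oo --> (mu : {ptws {poly rat} -> R}).
  apply/cvg_sup => v; rewrite cvg_image; last first.
    by rewrite eqEsubset; split=> r // _; exists (cst r).
  apply: cvg_trans (uv v) => W /= uW; exists (@^~ v @^-1` W); first exact: uW.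
  by rewrite eqEsubset; split => [r [g Wg <-//]|r Wr]; exists (fun=> r).
move=> /(_ B) H; suff : \forall k \near \oo, B (u k).
  by apply: filterS => k Bk; apply: BO.
by apply: H; apply: open_nbhs_nbhs.
Qed.

(** After division by its l1 norm [t], the coordinates of [a] lie in [-1, 1]; each is rounded down
    to a multiple of 1/(M+1), encoded by an index in 0..2(M+1). *)
Lemma grid_approx N M (a : {poly rat}) (t : rat) :
  (size a <= N)%N -> t = \sum_(i < size a) `|a`_i| ->
  exists phi : {ffun 'I_N -> 'I_(2 * M.+1).+1}, forall i, (i < N)%N ->
    `|(a - t *: \poly_(j < N)
        (((oapp phi ord0 (insub j))%:R - M.+1%:R) / M.+1%:R))`_i| <= t / M.+1%:R.
Proof.
move=> aN tE; have t0 : 0 <= t by rewrite tE sumr_ge0.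
have m0 : 0 < M.+1%:R :> rat by [].
have at1 i : `|a`_i| <= t.
  have [ai|?] := ltnP i (size a); last by rewrite nth_default ?normr0.
  by rewrite tE (bigD1 (Ordinal ai))//= lerDl sumr_ge0.
pose y i : rat := M.+1%:R * (a`_i / t) + M.+1%:R.
have [t_eq0|t_neq0] := eqVneq t 0.
  exists [ffun=> ord0] => i iN; by have := at1 i; rewrite t_eq0 scale0r subr0 mul0r.
have t_gt0 : 0 < t by rewrite lt_def t_neq0.
have ay i : `|a`_i / t| <= 1.
  by rewrite normrM normfV (ger0_norm t0) ler_pdivrMr// mul1r.
have y0 i : 0 <= y i.
  by have := ay i; rewrite ler_norml => /andP[]; rewrite /y; nra.
have yM i : y i <= (2 * M.+1)%:R.
  by have := ay i; rewrite ler_norml natrM => /andP[]; rewrite /y; nra.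
exists [ffun i : 'I_N => inord (Num.truncn (y i))] => i iN.
rewrite coefB coefZ coef_poly iN insubT/= ffunE /=.
have /andP[] := truncn_itv (y0 i); set k := Num.truncn _ => ky yk.
rewrite inordK; last by rewrite ltnS -(ler_nat rat) (le_trans ky).
have -> : a`_i - t * ((k%:R - M.+1%:R) / M.+1%:R) = t / M.+1%:R * (y i - k%:R).
  by rewrite /y; field; rewrite t_neq0 /=; lra.
rewrite normrM ger0_norm ?divr_ge0// ler_piMr ?divr_ge0//.
by rewrite ger0_norm ?subr_ge0// lerBlDl -natr1 in yk *; exact: ltW.
Qed.

Lemma l1_net N mu e : 0 < e -> exists (F : seq {poly rat}) (d : R), 0 < d /\
  forall nu, (forall v, v \in F -> `|nu v - mu v| < d) ->
    forall a : {poly rat}, (size a <= N)%N -> `|nu a - mu a| <= e * l1 a.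
Proof.
(* The finite grid of [grid_approx] stands in for compactness of the l1 sphere: control on grid
   points spreads by a common Lipschitz constant. The 1 added in [C] makes it serve [nu] as well as
   [mu]. *)
move=> e0; pose C := \sum_(i < N) mu 'X^i + 1.
have C0 : 0 < C by rewrite ltr_pwDr// sumr_ge0// => i _; exact: pseudonorm_ge0.
(* With this mesh, rounding costs at most [e / 4] for each of [mu] and [nu], leaving [e / 2] for the
   grid point. *)
have [M MC] : exists M, 4 * C * N%:R / e < M.+1%:R.
  exists (Num.truncn (4 * C * N%:R / e)).
  have q0 : 0 <= 4 * C * N%:R / e by rewrite divr_ge0 ?(ltW e0)// !mulr_ge0// ltW.
  by have /andP[] := truncn_itv q0.
pose d := Num.min 1 (e / 2); have d0 : 0 < d by rewrite lt_min ltr01 divr_gt0.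
pose w (phi : {ffun 'I_N -> 'I_(2 * M.+1).+1}) : {poly rat} :=
  \poly_(i < N) (((oapp phi ord0 (insub i))%:R - M.+1%:R) / M.+1%:R).
exists ([seq 'X^(val i) | i : 'I_N] ++ [seq w phi | phi : {ffun 'I_N -> 'I_(2 * M.+1).+1}]), d.
split=> // nu Fd a aN; pose t : rat := \sum_(i < size a) `|a`_i|.
have [phi] := grid_approx M aN (erefl t); rewrite -/(w phi) => at_.
have tE : ratr t = l1 a :> R.
  by rewrite /t rmorph_sum; apply: eq_bigr => i _ /=; rewrite ratr_norm.
have muC i : (i < N)%N -> mu 'X^i + 1 <= C.
  move=> iN; rewrite lerD2r (bigD1 (Ordinal iN))//= lerDl sumr_ge0// => j _.
  exact: pseudonorm_ge0.
have nuC i : (i < N)%N -> nu 'X^i <= C.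
  move=> iN; apply: le_trans (muC i iN); have : `|nu 'X^i - mu 'X^i| < d.
    apply: Fd; rewrite mem_cat; apply/orP; left; apply/mapP.
    by exists (Ordinal iN); rewrite ?mem_enum.
  rewrite ltr_norml => /andP[_]; rewrite lt_min => /andP[+ _]; lra.
have wN : (size (a - t *: w phi)%R <= N)%N.
  rewrite (leq_trans (size_polyD _ _))// geq_max aN size_polyN.
  by rewrite (leq_trans (size_scale_leq _ _))// size_poly.
have small (p : pseudonorms R) : (forall i, (i < N)%N -> p 'X^i <= C) ->
    `|p a - p (t *: w phi)| <= e / 4 * l1 a.
  move=> pC; rewrite (le_trans (pseudonorm_dist _ _ _))//.
  rewrite (le_trans (le_l1 wN pC))//.
  have : l1 (a - t *: w phi) <= N%:R * (l1 a / M.+1%:R) :> R.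
    rewrite (l1E _ wN) -[N in N%:R]card_ord -sum1_card natr_sum mulr_suml ler_sum// => i _.
    by rewrite mul1r -tE -ratr_nat -fmorphV -rmorphM -ratr_norm ler_rat at_.
  move=> /(ler_wpM2l (ltW C0)) /le_trans; apply.
  have -> : C * (N%:R * (l1 a / M.+1%:R)) = (C * N%:R / M.+1%:R) * l1 a.
    by rewrite !mulrA [RHS]mulrAC.
  rewrite ler_wpM2r ?l1_ge0// ler_pdivrMr// mulrAC ler_pdivlMr//.
  by move: MC; rewrite ltr_pdivrMr//; lra.
have muC' i : (i < N)%N -> mu 'X^i <= C by move=> /(muC i); lra.
have := small nu nuC; have := small mu muC'.
have : `|nu (t *: w phi) - mu (t *: w phi)| <= e / 2 * l1 a.
  rewrite !pseudonormZ -mulrBr normrM /= [ratr `|t|]ratr_norm normr_id tE.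
  rewrite ger0_norm ?l1_ge0// mulrC ler_wpM2r ?l1_ge0//.
  have : `|nu (w phi) - mu (w phi)| < d.
    by apply: Fd; rewrite mem_cat; apply/orP; right; apply/mapP; exists phi; rewrite ?mem_enum.
  by rewrite lt_min => /andP[_ /ltW].
rewrite !ler_norml => /andP[? ?] /andP[? ?] /andP[? ?].
by apply/andP; split; lra.
Qed.

Lemma nbhs_l1 N mu e : 0 < e ->
  nbhs mu [set nu : pseudonorms R |
    forall a : {poly rat}, (size a <= N)%N -> `|nu a - mu a| <= e * l1 a].
Proof.
move=> e0; have [F [d [d0 Fd]]] := l1_net N mu e0.
suff : nbhs mu [set nu : pseudonorms R | forall v, v \in F -> `|nu v - mu v| < d].
  by apply: filterS => nu; exact: Fd.
elim: F {Fd} => [|v F IH]; first exact: filterS filterT.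
apply: filterS2 IH (nbhs_eval mu v d0) => nu nuF nuv w.
by rewrite inE => /orP[/eqP -> //|/nuF].
Qed.

(** Finite lists of rational interval constraints are countable, and one pseudonorm is chosen for
    each satisfiable list. By [l1_net] such a list around [mu] forces l1-closeness. *)
Lemma countable_l1_dense : exists P : nat -> pseudonorms R,
  forall mu N e, 0 < e -> exists j, forall a : {poly rat}, (size a <= N)%N ->
    `|P j a - mu a| <= e * l1 a.
Proof.
pose inside (nu : pseudonorms R) (s : seq ({poly rat} * (rat * rat))) :=
  all (fun q => ratr q.2.1 < nu q.1 < ratr q.2.2) s.
have /choice[P PP] j : exists nu : pseudonorms R, forall s mu,
    unpickle j = Some s -> inside mu s -> inside nu s.
  case: (unpickle j) => [s|]; last by exists l1_pn.
  have [[nu nus]|H] := pselect (exists nu, inside nu s).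
    by exists nu => s' mu [<-].
  by exists l1_pn => s' nu [<-] nus; case: H; exists nu.
exists P => mu N e e0; have [F [d [d0 Fd]]] := l1_net N mu e0.
have /choice[q qP] v : exists q : rat * rat,
    (ratr q.1 < mu v < ratr q.2) /\ ratr q.2 - ratr q.1 < d.
  have /rat_in_itvoo[q1] : mu v - d / 2 < mu v by rewrite ltrBlDl ltrDr divr_gt0.
  have /rat_in_itvoo[q2] : mu v < mu v + d / 2 by rewrite ltrDl divr_gt0.
  rewrite !in_itv /= => /andP[? ?] /andP[? ?].
  by exists (q1, q2) => /=; split; [apply/andP|lra].
pose s := [seq (v, q v) | v <- F].
exists (pickle s) => a aN; apply: Fd aN => v vF.
have := PP _ s mu (pickleK s) => /(_ _) /allP.
have inmu : inside mu s by apply/allP => _ /mapP[u _ ->]; exact: (qP u).1.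
move=> /(_ inmu (v, q v) (map_f _ vF)) /= /andP[? ?].
by have [/andP[? ?] ?] := qP v; rewrite ltr_norml; apply/andP; split; lra.
Qed.

End pointwise_topology.

(** * Rational vectors and dense sequences *)

Section rational_density.
Context (R : realType).

Lemma lc_rat_approx (X : normedModType R) (x : nat -> X) A e : 0 < e ->
  exists a : {poly rat}, `|lc x A - lc x (toR a)| < e.
Proof.
move=> e0; pose s := \sum_(i < size A) `|x i| + 1.
have s0 : 0 < s by rewrite ltr_pwDr// sumr_ge0.
have /choice[q qP] i : exists q : rat, `|A`_i - ratr q| <= e / s / 2.
  have d0 : 0 < e / s / 2 by rewrite !divr_gt0.
  have /rat_in_itvoo[q] : A`_i < A`_i + e / s / 2 by rewrite ltrDl.
  rewrite in_itv /= => /andP[xq qx]; exists q.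
  by rewrite distrC ger0_norm ?subr_ge0 1?ltW// ltrBlDl.
exists (\poly_(i < size A) q i).
rewrite (@lcE _ _ (size A) _ (toR _)) ?size_map_poly ?size_poly//.
rewrite /lc -sumrB (le_lt_trans (ler_norm_sum _ _ _))//.
apply: (@le_lt_trans _ _ (e / s / 2 * \sum_(i < size A) `|x i|)).
  rewrite mulr_sumr ler_sum// => i _.
  by rewrite -scalerBl normrZ coef_map coef_poly ltn_ord ler_wpM2r ?qP.
apply: (@le_lt_trans _ _ (e / s / 2 * s)).
  by rewrite ler_wpM2l ?lerDl// ltW// !divr_gt0.
by rewrite mulrAC divfK ?gt_eqF//; lra.
Qed.

Lemma dense_seq_range (X : normedModType R) (s : nat -> X) :
  (forall z e, 0 < e -> exists k, `|s k - z| < e) -> exists d : nat -> X, dense_seq d.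
Proof.
(* Indexing by the 2-adic valuation repeats every [s j] infinitely often: [2 ^ j * 3 ^ m] has
   valuation [j] and is at least [m]. *)
move=> sX; exists (fun k => s (logn 2 k)) => z e m /(sX z)[j js].
exists (2 ^ j * 3 ^ m)%N; split.
  by rewrite (leq_trans (ltnW (ltn_expl m (isT : 1 < 3)%N)))// leq_pmull// expn_gt0.
by rewrite lognM ?expn_gt0// pfactorK// lognX (_ : logn 2 3 = 0%N)// muln0 addn0.
Qed.

Lemma separable_dense_seq (X : normedModType R) : separable X -> exists d : nat -> X, dense_seq d.
Proof.
move=> [D [/countable_injP[f finj] dD]].
have ballD z e : 0 < e -> exists2 w, D w & `|w - z| < e.
  move=> e0; have [|w [zw Dw]] := dD _ _ (@ball_open _ X z e).
    by exists z; exact: ballxx.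
  by exists w => //; move: zw; rewrite -ball_normE /= distrC.
have /choice[s sP] k : exists w, forall w', D w' -> f w' = k -> w = w'.
  have [[w [Dw wk]]|H] := pselect (exists w, D w /\ f w = k).
    by exists w => w' Dw' w'k; apply: finj; rewrite ?inE// w'k.
  by exists 0 => w' Dw' w'k; case: H; exists w'.
apply: (@dense_seq_range _ s) => z e /(ballD z)[w Dw zw].
by exists (f w); rewrite (sP _ w).
Qed.

Definition rat_vec (mu : pseudonorms R) (v : {poly rat}) : banach_of mu :=
  lc (basis_vec mu) (toR v).

Lemma norm_rat_vecB mu v w : `|rat_vec mu v - rat_vec mu w| = mu (v - w).
Proof. by rewrite -lcB -rmorphB norm_lc_basis_vec_rat. Qed.

(** A norm in X_mu becomes the value of [mu] at one rational vector, which is continuous in [mu]. *)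
Lemma norm_lc_rat_vec mu (x : nat -> {poly rat}) a :
  `|lc (fun i => rat_vec mu (x i)) (toR a)| = mu (lc x a).
Proof.
rewrite -norm_lc_basis_vec_rat; congr `|_|.
rewrite [lc x a]/lc (raddf_sum (map_poly ratr)) lc_sum (@lcE _ _ (size a)) ?size_map_poly//.
by apply: eq_bigr => i _; rewrite coef_map /= map_polyZ lcZ.
Qed.

Lemma rat_vec_dense mu z e : 0 < e -> exists v, `|rat_vec mu v - z| < e.
Proof.
move=> e0; have e2 : 0 < e / 2 by rewrite divr_gt0.
have [A zA] := spans_basis_vec z e2; have [a Aa] := lc_rat_approx (basis_vec mu) A e2.
exists a; rewrite distrC.
by rewrite (le_lt_trans (ler_distD (lc (basis_vec mu) A) _ _))// [e]splitr ltrD.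
Qed.

Lemma banach_of_dense_seq (mu : pseudonorms R) :
  exists d : nat -> banach_of mu, dense_seq d.
Proof.
pose s k := if unpickle k is Some a then rat_vec mu a else 0.
apply: (@dense_seq_range _ s) => z e /(rat_vec_dense z)[a az].
by exists (pickle a); rewrite /s pickleK.
Qed.

End rational_density.

(** * The G-delta part *)

Section Gdelta.
Context (R : realType).

Lemma dist3 (a b c d r s t : R) : `|a - b| <= r -> `|b - c| <= s -> `|c - d| <= t ->
  `|a - d| <= r + s + t.
Proof.
move=> ab bc cd; rewrite (le_trans (ler_distD c _ _))// lerD//.
by rewrite (le_trans (ler_distD b _ _))// lerD.
Qed.

Lemma extension_property_isometric (X Y : normedModType R) :
  linearly_isometric X Y -> extension_property Y -> extension_property X.
Proof.
move=> [T [Tnorm Tsurj]] eY n N x p delta eta delta0 eta0 px.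
have /choice[S ST] := Tsurj.
have [|z [zx zp]] := eY n N (fun i => T (x i)) p delta eta delta0 eta0.
  by move=> a an; rewrite lc_comp Tnorm px.
exists (fun i => S (z i)); split => [i ni|a aN].
  by rewrite -Tnorm linearB ST zx.
rewrite -Tnorm -lc_comp (_ : (fun i => T (S (z i))) = z) ?zp//.
by apply/funext => i; rewrite ST.
Qed.

(* The instance of the extension property for rational vectors x i: either its
   hypothesis fails at mu, or its conclusion is witnessed by rational vectors. *)
Definition rational_extension n N (x : nat -> {poly rat}) (p : pseudonorms R)
    (delta eta : R) : set (pseudonorms R) :=
  [set mu | (exists2 a : {poly rat}, (size a <= n)%N &
               delta * l1 a < `|p a - mu (lc x a)|) \/
            exists z, (forall i, (i < n)%N -> mu (z i - x i) <= delta + eta) /\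
              forall a : {poly rat}, (size a <= N)%N -> `|mu (lc z a) - p a| <= eta * l1 a].

(** A failing hypothesis is a strict inequality at one vector, hence stable. Otherwise extendibility
    is used with [eta / 4], rounding to rational vectors costs another [eta / 4], and [eta / 2] is
    left for varying [mu]. *)
Lemma rational_extension_interior n N x p delta eta mu :
  0 <= delta -> 0 < eta -> extension_property (banach_of mu) ->
  (rational_extension n N x p delta eta)° mu.
Proof.
move=> delta0 eta0 emu; set V := rational_extension _ _ _ _ _ _.
have [[a an ax]|nax] := pselect (exists2 a : {poly rat}, (size a <= n)%N &
    delta * l1 a < `|p a - mu (lc x a)|).
  have e0 : 0 < `|p a - mu (lc x a)| - delta * l1 a by rewrite subr_gt0.
  apply: filterS (nbhs_eval mu (lc x a) e0) => nu /= nuV; left; exists a => //.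
  have := ler_distD (nu (lc x a)) (p a) (mu (lc x a)); lra.
have eta4 : 0 < eta / 4 by rewrite divr_gt0.
have [|z' [z'x z'p]] := emu n N (fun i => rat_vec mu (x i)) p delta (eta / 4) delta0 eta4.
  by move=> a an; rewrite norm_lc_rat_vec leNgt; apply/negP => ax; apply: nax; exists a.
have /choice[z zz'] i := rat_vec_dense (z' i) eta4.
pose k := maxn n N.
pose B : R := \sum_(i < k) (l1 (z i) + l1 (x i)).
have B0 : 0 <= B by apply: sumr_ge0 => i _; rewrite addr_ge0 ?l1_ge0.
pose e := eta / 2 / (B + 1).
have B1 : 0 < B + 1 by rewrite ltr_pwDr.
have e0 : 0 < e by rewrite !divr_gt0.
have eB : e * (B + 1) = eta / 2 by rewrite divfK// gt_eqF.
have zB i : (i < k)%N -> l1 (z i) + l1 (x i) <= B.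
  move=> ik; rewrite /B (bigD1 (Ordinal ik))//= lerDl sumr_ge0// => j _.
  by rewrite addr_ge0 ?l1_ge0.
pose m := \max_(i < k) maxn (size (z i)) (size (x i)).
have zm i : (i < k)%N -> (size (z i) <= m)%N /\ (size (x i) <= m)%N.
  move=> ik; apply/andP; rewrite -geq_max.
  exact: (leq_bigmax (Ordinal ik)).
apply: filterS (nbhs_l1 m mu e0) => nu nuP; right; exists z; split => [i ni|a aN].
  have ik : (i < k)%N by rewrite leq_max ni.
  have zxm : (size (z i - x i)%R <= m)%N.
    by rewrite (leq_trans (size_polyD _ _))// geq_max size_polyN (zm i ik).1 (zm i ik).2.
  have := nuP _ zxm; rewrite ler_norml => /andP[_].
  have : e * l1 (z i - x i) <= e * (B + 1).
    rewrite ler_wpM2l ?(ltW e0)//; have := l1D R (z i) (- x i); rewrite l1N.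
    by have := zB i ik; lra.
  have : mu (z i - x i) <= delta + eta / 4 + eta / 4.
    rewrite -norm_rat_vecB (le_trans (ler_distD (z' i) _ _))//.
    by rewrite (le_trans (lerD (ltW (zz' i)) (z'x i ni)))// addrCA addrA.
  lra.
have zk i : (i < N)%N -> (i < k)%N by move=> iN; rewrite leq_max iN orbT.
have lza : (size (lc z a) <= m)%N.
  rewrite (lcE _ aN) (leq_trans (size_sum _ _ _))//; apply/bigmax_leqP => i _.
  by rewrite (leq_trans (size_scale_leq _ _))// (zm i (zk i _)).1.
have l1za : l1 (lc z a) <= B * l1 a :> R.
  rewrite (lcE _ aN) (le_trans (pseudonorm_sum l1_pn _ _))//=.
  rewrite (l1E _ aN) mulr_sumr ler_sum// => i _; rewrite l1Z /= ratr_norm mulrC.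
  rewrite ler_wpM2r//; have := zB i (zk i (ltn_ord i)).
  by have := l1_ge0 R (x i); lra.
have := nuP _ lza; have := z'p a aN.
have := lc_dist aN (fun i _ => ltW (zz' i)); rewrite norm_lc_rat_vec.
have : e * l1 (lc z a) <= eta / 2 * l1 a.
  rewrite -eB -mulrA ler_wpM2l ?(ltW e0)// (le_trans l1za)// ler_wpM2r ?l1_ge0//.
  by rewrite lerDl.
rewrite !ler_norml => ? /andP[? ?] /andP[? ?] /andP[? ?].
by apply/andP; split; lra.
Qed.

(** Arbitrary data are replaced by nearby countable data at the price of slightly enlarging [delta]
    and shrinking [eta]. *)
Lemma extension_property_of_rational (P : nat -> pseudonorms R) mu :
  (forall (nu : pseudonorms R) N e, 0 < e -> exists j, forall a : {poly rat}, (size a <= N)%N ->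
    `|P j a - nu a| <= e * l1 a) ->
  (forall n N xs j (delta eta : rat), 0 <= delta -> 0 < eta ->
    rational_extension n N (nth 0 xs) (P j) (ratr delta) (ratr eta) mu) ->
  extension_property (banach_of mu).
Proof.
move=> Pdense muP n N x p delta eta delta0 eta0 px.
pose e := eta / 8; have e0 : 0 < e by rewrite divr_gt0.
have /choice[x' xx'] i : exists v, `|x i - rat_vec mu v| < e.
  by have [v] := rat_vec_dense (x i) e0; exists v; rewrite distrC.
have [j Pj] := Pdense p (maxn n N) e e0.
(* Approximating both [p] and the [x i] raises the error to [delta + 2 * e]; exceeding it, [q] rules
   out the first alternative of [rational_extension]. *)
have /rat_in_itvoo[q] : delta + 2 * e < delta + 3 * e by lra.
rewrite in_itv /= => /andP[q1 q2].
have /rat_in_itvoo[r] : 0 < e by [].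
rewrite in_itv /= => /andP[r1 r2].
have q0 : 0 <= q by rewrite -(ler0q R); lra.
have r0 : 0 < r by rewrite -(ltr0q R).
have x'E i : (i < n)%N -> (mkseq x' n)`_i = x' i by move=> ni; rewrite nth_mkseq.
case: (muP n N (mkseq x' n) j q r q0 r0) => [[a an]|[z [zx zP]]].
  rewrite (eq_lc an x'E) -norm_lc_rat_vec => H; exfalso.
  have := lt_le_trans H (dist3 (Pj a (leq_trans an (leq_maxl _ _))) (px a an)
    (lc_dist an (fun i _ => ltW (xx' i)))).
  by rewrite -!mulrDl ltNge ler_wpM2r ?l1_ge0//; lra.
exists (fun i => rat_vec mu (z i)); split => [i ni|a aN].
  rewrite (le_trans (ler_distD (rat_vec mu (x' i)) _ _))//.
  have := zx i ni; rewrite x'E// norm_rat_vecB; have := xx' i; rewrite distrC.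
  by rewrite /e in e0 q2 r2 *; lra.
rewrite norm_lc_rat_vec (le_trans (ler_distD (P j a) _ _))//.
have := Pj a (leq_trans aN (leq_maxr _ _)); have := zP a aN.
have := @l1_ge0 R a; rewrite /e in r2 *; nra.
Qed.

(** The open sets are the interiors of the instances with coded countable data; codes without
    admissible data give the whole space. *)
Lemma Gdelta_extension_property :
  Gdelta [set mu : pseudonorms R | extension_property (banach_of mu)].
Proof.
have [P Pdense] := countable_l1_dense R.
pose V (q : nat * nat * seq {poly rat} * nat * (rat * rat)) : set (pseudonorms R) :=
  let: (n, N, xs, j, (delta, eta)) := q in
  if (0 <= delta) && (0 < eta) then
    (rational_extension n N (nth 0 xs) (P j) (ratr delta) (ratr eta))°
  else setT.
exists (fun k => if unpickle k is Some q then V q else setT).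
  move=> k; case: (unpickle k) => [[[[[n N] xs] j] [delta eta]]|]; last exact: openT.
  by rewrite /V; case: ifP => _; [exact: open_interior|exact: openT].
apply/seteqP; split => [mu emu k _|mu muV].
  case: (unpickle k) => [[[[[n N] xs] j] [delta eta]]|]//=; case: ifP => // /andP[d0 e0].
  by apply: rational_extension_interior; rewrite ?ler0q ?ltr0q.
apply: (extension_property_of_rational Pdense) => n N xs j delta eta d0 e0.
have := muV (pickle (n, N, xs, j, (delta, eta))) Logic.I.
by rewrite pickleK /= d0 e0 /=; exact: interior_subset.
Qed.

End Gdelta.

(** * Density *)

Section density.
Context (R : realType).

(** Extending the zero map embeds an (n+1)-dimensional space into G, which [n] vectors cannot span:
    the coefficient matrix of the images has a nonzero kernel. *)
Lemma gurarii_infinite_dimensional (G : completeNormedModType R) :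
  gurarii G -> ~ finite_dimensional G.
Proof.
move=> [_ gG] [n [v vG]].
pose B : completeNormedModType R := HB.pack 'rV[R]_n.+1.
have [||||f [[flin fK] _]] := gG 1 B (pred1 0) (fun=> 0) ltr01.
- exists n.+1, (fun i => delta_mx 0 i) => x; exists (x 0).
  exact: row_sum_delta.
- split=> [|a x y]; rewrite !inE// => /eqP -> /eqP ->.
  by rewrite scaler0 addr0.
- by move=> a x y _ _; rewrite scaler0 addr0.
- by move=> x; rewrite inE => /eqP ->; rewrite !normr0.
pose f' : {linear B -> G} :=
  HB.pack f (GRing.isLinear.Build R B G *:%R f flin).
have /choice[c cP] (i : 'I_n.+1) := vG (f (delta_mx 0 i)).
pose M : 'M[R]_(n.+1, n) := \matrix_(i, j) c i j.
have : kermx M != 0.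
  rewrite kermx_eq0 /row_free; apply/eqP => rM.
  by have := rank_leq_col M; rewrite rM ltnn.
move=> /rowV0Pn[u /sub_kermxP uM u0].
have fu : f u = 0.
  have fsum (b : 'I_n.+1 -> B) : f (\sum_i u 0 i *: b i) = \sum_i u 0 i *: f (b i).
    by rewrite -[f _]/(f' _) linear_sum; apply: eq_bigr => i _; rewrite linearZ.
  transitivity (f (\sum_i u 0 i *: (delta_mx 0 i : B))).
    by congr f; exact: row_sum_delta.
  rewrite fsum; under eq_bigr => i _ do rewrite cP scaler_sumr.
  rewrite exchange_big /= big1 // => j _.
  under eq_bigr => i _ do rewrite scalerA.
  rewrite -scaler_suml; have /rowP/(_ j) := uM; rewrite !mxE => uMj.
  rewrite (_ : \sum_(i < n.+1) _ = 0) ?scale0r// -[RHS]uMj.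
  by apply: eq_bigr => i _; rewrite mxE.
have /andP[+ _] := fK u; rewrite fu normr0 pmulr_rle0 ?invr_gt0 ?addr_gt0// => u_le0.
by move: u_le0; rewrite (@normr_le0 _ B) (negPf u0).
Qed.

Lemma finite_dimensional_isometric (X Y : normedModType R) :
  linearly_isometric X Y -> finite_dimensional X -> finite_dimensional Y.
Proof.
move=> [T [_ Tsurj]] [n [v vX]]; exists n, (fun i => T (v i)) => y.
have [x <-] := Tsurj y; have [a ->] := vX x; exists a.
by rewrite linear_sum; apply: eq_bigr => i _; rewrite linearZ.
Qed.

(** If [d] lies in the span, adding a small multiple of a vector [w] outside the span leaves it. *)
Lemma near_not_in_span (X : normedModType R) (x : nat -> X) n d e :
  ~ finite_dimensional X -> 0 < e ->
  exists y, `|y - d| <= e /\ forall A : {poly R}, (size A <= n)%N -> y <> lc x A.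
Proof.
move=> fX e0; have [w wx] : exists w, forall A : {poly R}, (size A <= n)%N -> w <> lc x A.
  apply: contrapT => H; apply: fX; exists n, (fun i : 'I_n => x i) => w.
  apply: contrapT => wx; apply: H; exists w => A An wA; apply: wx.
  by exists (fun i => A`_i); rewrite wA; exact: lcE.
have [[B Bn ->]|dx] := pselect (exists2 B : {poly R}, (size B <= n)%N & d = lc x B); last first.
  exists d; rewrite subrr normr0 ltW//; split=> // A An dA; apply: dx; by exists A.
have w0 : 0 < `|w| + 1 by rewrite ltr_pwDr.
pose t := e / (`|w| + 1); have t0 : 0 < t by rewrite divr_gt0.
exists (lc x B + t *: w); split.
  rewrite addrAC subrr add0r normrZ gtr0_norm// -[leRHS](divfK (lt0r_neq0 w0)).
  by rewrite ler_wpM2l ?lerDl// ltW.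
move=> A An tw; apply: (wx (t^-1 *: (A - B))).
  rewrite (leq_trans (size_scale_leq _ _))// (leq_trans (size_polyD _ _))//.
  by rewrite geq_max size_polyN An.
by rewrite lcZ lcB -tw addrAC subrr add0r scalerK// lt0r_neq0.
Qed.

Lemma independent_perturbation (X : normedModType R) (t : nat -> X) (e : nat -> R) :
  ~ finite_dimensional X -> (forall i, 0 < e i) ->
  exists x : nat -> X, (forall i, `|x i - t i| <= e i) /\ forall A, lc x A = 0 -> A = 0.
Proof.
move=> fX e0.
pose Inv k (s : nat -> X) := (forall i, (i < k)%N -> `|s i - t i| <= e i) /\
  forall A : {poly R}, (size A <= k)%N -> lc s A = 0 -> A = 0.
pose step k (s s' : nat -> X) := forall i, (i < k)%N -> s' i = s i.
have [|k s [st sfree]|u uP] := @iterated_choice _ Inv step (fun=> 0).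
- by split=> // A; rewrite leqn0 size_poly_eq0 => /eqP.
- have [y [yt ys]] := near_not_in_span s k (t k) fX (e0 k).
  pose s' i := if i == k then y else s i.
  have ss' i : (i < k)%N -> s' i = s i by move=> ik; rewrite /s' ltn_eqF.
  exists s'; split=> //; split=> [i|A Ak].
    by rewrite ltnS leq_eqVlt => /orP[/eqP ->|ik]; [rewrite /s' eqxx|rewrite ss'// st].
  have tk := size_take_poly k A.
  rewrite {1}(poly_recr Ak) lcD lcZ lcXn {2}/s' eqxx (eq_lc tk ss') => A0.
  have Ak0 : A`_k = 0.
    have [//|Ak0] := eqVneq A`_k 0; case: (ys (- (A`_k)^-1 *: take_poly k A)).
      by rewrite (leq_trans (size_scale_leq _ _)).
    rewrite lcZ scaleNr -[y](scalerK Ak0) -scalerN; congr (_ *: _).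
    by apply/eqP; rewrite -addr_eq0 addrC A0.
  by rewrite (poly_recr Ak) Ak0 scale0r addr0; apply: sfree => //; rewrite -A0 Ak0 scale0r addr0.
(* Entry [i] is fixed from stage [i.+1] on, so the diagonal sequence inherits every invariant. *)
have uE i k : (i < k)%N -> u k i = u i.+1 i.
  elim: k => // k IH; rewrite ltnS leq_eqVlt => /orP[/eqP -> //|ik].
  by rewrite (uP k).2// IH.
exists (fun i => u i.+1 i); split=> [i|A]; first by have [[+ _] _] := uP i.+1; exact.
have [[_ +] _] := uP (size A) => /(_ A (leqnn _)) H uA; apply: H; rewrite -uA.
by apply: (@eq_lc _ _ (size A)) => // i iA; rewrite uE.
Qed.

Lemma isometry_class_approx (G : completeNormedModType R) (mu : pseudonorms R) k :
  gurarii G -> exists nu : pseudonorms R,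
    [/\ P_norm R nu, linearly_isometric (banach_of nu) G &
        forall a : {poly rat}, (size a <= k)%N -> `|nu a - mu a| <= 2 * 2^-1 ^+ k * l1 a].
Proof.
move=> gG; have infG := gurarii_infinite_dimensional gG.
have [d dG] := separable_dense_seq gG.1.
have [a|z [_ zmu]] := 
  @gurarii_extension_property R G gG 0%N k (fun=> 0) mu 0 _ (lexx 0) (half_pow_gt0 R k).
  rewrite leqn0 size_poly_eq0 => /eqP ->.
  by rewrite rmorph0 linear0 normr0 pseudonorm0 subr0 normr0 l10 mulr0.
pose t i := if (i < k)%N then z i else d i.
(* The tolerance 2^-k on the first [k] entries keeps the total error at 2 * 2^-k; the decreasing one
   afterwards keeps the perturbed tail of [d] dense. *)
pose e i : R := if (i < k)%N then 2^-1 ^+ k else 2^-1 ^+ i.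
have e0 i : 0 < e i by rewrite /e; case: ifP => _; exact: half_pow_gt0.
have [x [xt xfree]] := independent_perturbation t infG e0.
have isoG : linearly_isometric (banach_of (lc_pn x)) G.
  apply: (@isometric_lc _ _ _ (basis_vec (lc_pn x)) x) => [A||w r r0].
  - by rewrite norm_lc_basis_vec extension_lc_pn.
  - exact: spans_basis_vec.
  have r2 : 0 < r / 2 by rewrite divr_gt0.
  have [k0 hk0] := half_pow_lt r2.
  have [i [+ dw]] := dG w _ (maxn k k0) r2; rewrite geq_max => /andP[ki k0i].
  exists 'X^i; rewrite lcXn distrC (le_lt_trans (ler_distD (d i) _ _))//.
  have := xt i; rewrite /t /e ltnNge ki /=; have := hk0 i k0i; lra.
exists (lc_pn x); split => //.
  split=> [fd|A]; first exact: infG (finite_dimensional_isometric isoG fd).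
  by rewrite extension_lc_pn => /eqP; rewrite normr_eq0 => /eqP /xfree.
move=> a ak /=; rewrite (le_trans (ler_distD `|lc z (toR a)| _ _))//.
rewrite mulr_natl mulr2n mulrDl lerD ?zmu//; apply: lc_dist ak _ => i ik.
by have := xt i; rewrite /t /e ik.
Qed.

End density.

Theorem theorem2 (R : realType) (G : completeNormedModType R) :
  gurarii G ->
  forall I : set (pseudonorms R),
    I = [set: pseudonorms R]%classic \/ I = P_infinite R \/ I = P_norm R ->
    dense (isometry_class I G) /\ Gdelta (isometry_class I G).
Proof.
move=> gG I IE; have eG := gurarii_extension_property gG.
(* Each admissible [I] contains [P_norm R], so approximation by norms settles density in all three
   cases. *)
have normI nu : P_norm R nu -> I nu.
  by case: IE => [->//|[->|->//]] [].
split; last first.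
  (* In [I] the isometry class is the trace of the extendible pseudonorms: one inclusion transports
     extendibility from G, the other is back-and-forth. *)
  have [F oF FE] := Gdelta_extension_property R.
  exists (fun k => set_val @^-1` F k); first by move=> k; exists (F k).
  rewrite -preimage_bigcap -FE; apply/seteqP; split => mu /=.
    by move=> /extension_property_isometric; apply.
  move=> emu; have [d dmu] := banach_of_dense_seq (set_val mu).
  have [f fG] := separable_dense_seq gG.1.
  exact: back_and_forth dmu fG.
move=> O [mu Omu] [B oB BO]; have Bmu : B (set_val mu) by move: Omu; rewrite -BO.
have /choice[u uP] k := isometry_class_approx (set_val mu) k gG.
have /(_ B) uB : u @ \oo --> set_val mu.
  apply: cvg_pseudonorms => v; apply/fcvgrPdist_lt => e e0.
  have l0 : 0 < 2 * l1 v + 1 :> R by rewrite ltr_pwDr// mulr_ge0// l1_ge0.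
  have [k0 hk0] := half_pow_lt (divr_gt0 e0 l0).
  exists (maxn k0 (size v)) => // k /=; rewrite geq_max => /andP[k0k vk].
  have [_ _ /(_ v vk)] := uP k; rewrite distrC => /le_lt_trans; apply.
  have := hk0 k k0k; rewrite ltr_pdivlMr//.
  have := half_pow_gt0 R k; have := l1_ge0 R v; nra.
have [k Buk] : exists k, B (u k).
  have /uB[k _ Bk] : nbhs (set_val mu) B by apply: open_nbhs_nbhs.
  by exists k; apply: Bk => /=.
have [nk iso _] := uP k.
exists (exist _ (u k) (mem_set (normI _ nk))); split=> //.
by rewrite -BO.
Qed.
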